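(* Let $0<\epsilon<1<M<\infty$, $T>0$, $\Omega_T=(\epsilon,M)\times(0,T)$. Let $m\in C^1([\epsilon,M])$ satisfy $0<m_0<m(x)<m_1$ for all $x\in[\epsilon,M]$, where $0<m_0<m_1$ are two numbers, and let $m_2=\max_{[\epsilon,M]}|m'(x)|$. For $v\in H^2(\Omega_T)$ put $L_0v(x,t)=v_{xx}(x,t)-m(x)v_{xt}(x,t)$, $(x,t)\in\Omega_T$. 1. There exist a number $\alpha_0>0$ and a sufficiently large number $\lambda_0\ge 1$, both depending only on $m_0,m_1,m_2,\epsilon,T$, such that for all $\alpha\in(0,\alpha_0)$, all $\lambda\ge\lambda_0$ and all functions $v\in H^2(\Omega_T)$ the following Carleman estimate is valid: $$ \begin{aligned} \int_{\Omega_T}e^{-2\lambda(x+\alpha t)}|L_0v|^2\,dxdt\ \ge\ & C\lambda\int_{\Omega_T}e^{-2\lambda(x+\alpha t)}\big(|v_x|^2+|v_t|^2+\lambda^2|v|^2\big)\,dtdx\\ &-C\lambda\int_0^T e^{-2\lambda(\epsilon+\alpha t)}\big(|v_x(\epsilon,t)|^2+\lambda^2|v(\epsilon,t)|^2+|v_t(\epsilon,t)|^2\big)\,dt\\ &+C\lambda\int_\epsilon^M e^{-2\lambda x}\big(|v_x(x,0)|^2+\lambda^2|v(x,0)|^2\big)\,dx\\ &-C\lambda\int_\epsilon^M e^{-2\lambda(x+\alpha T)}\big(|v_x(x,T)|^2+\lambda^2|v(x,T)|^2\big)\,dx, \end{aligned} $$ where $C=C(m_0,m_1,m_2,\epsilon,M)>0$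 is a generic constant depending only on the listed parameters. 2. Let $g\in C^1(\overline{\Omega_T})$. There exist a number $\alpha_0>0$ and a sufficiently large number $\lambda_0\ge1$, both depending only on $m_0,m_1,m_2,\epsilon,M,\|g\|_{C^1(\overline{\Omega_T})},T$, such that for all $\alpha\in(0,\alpha_0)$, all $\lambda\ge\lambda_0$ and all functions $v\in H^2(\Omega_T)$ the following Carleman estimate is valid: $$ \begin{aligned} \int_{\Omega_T}e^{-2\lambda(x+\alpha t)}|L_0v|^2\,dxdt&+\int_{\Omega_T}e^{-2\lambda(x+\alpha t)}g(x,t)\,v_{xt}(x,t)\,v(x,0)\,dxdt\\ \ge\ & C\lambda\int_{\Omega_T}e^{-2\lambda(x+\alpha t)}\big(|v_x|^2+|v_t|^2+\lambda^2|v|^2\big)\,dtdx\\ &-C\lambda\int_0^T e^{-2\lambda(\epsilon+\alpha t)}\big(|v_x(\epsilon,t)|^2+\lambda^2|v(\epsilon,t)|^2+|v_t(\epsilon,t)|^2\big)\,dt\\ &+C\lambda\int_\epsilon^M e^{-2\lambda x}\big(|v_x(x,0)|^2+\lambda^2|v(x,0)|^2\big)\,dx\\ &-C\lambda\int_\epsilon^M e^{-2\lambda(x+\alpha T)}\big(|v_x(x,T)|^2+\lambda^2|v(x,T)|^2\big)\,dx, \end{aligned} $$ where $C=C(m_0,m_1,m_2,\epsilon,M,\|g\|_{C^1(\overline{\Omega_T})})>0$ is a generic constant depending only on the listed parameters.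
   Context: All functions are real valued. Subscripts $x,t$ denote partial derivatives. Boundary values $v(\epsilon,t)$, $v_x(\epsilon,t)$, $v_t(\epsilon,t)$, $v(x,0)$, $v_x(x,0)$, $v(x,T)$, $v_x(x,T)$ of $v\in H^2(\Omega_T)$ and its first derivatives are understood in the sense of traces. A ''generic constant'' $C$ may have different values at different occurrences; it does not depend on $\lambda$, $\alpha$ or $v$. *)

(* Defs.v *)
From HB Require Import structures.
From mathcomp Require Import all_boot all_order all_algebra.
From mathcomp Require Import all_classical all_reals all_analysis.

Set Implicit Arguments.
Unset Strict Implicit.
Unset Printing Implicit Defensive.

Import Order.TTheory GRing.Theory Num.Theory.
Import numFieldNormedType.Exports.

Local Open Scope classical_set_scope.
Local Open Scope ring_scope.

Definition leb1 (R : realType) := @lebesgue_measure R.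
Definition leb2 (R : realType) :=
  (@lebesgue_measure R \x @lebesgue_measure R)%E.
Arguments leb1 R : clear implicits.
Arguments leb2 R : clear implicits.

(* Points of the plane are pairs (x, t). *)
Definition orect (R : realType) (e M T : R) : set (R * R) :=
  `]e, M[ `*` `]0, T[.
Definition crect (R : realType) (e M T : R) : set (R * R) :=
  `[e, M] `*` `[0, T].

(* C^1 up to the boundary: the function is C^1 in the open set, and it and its
   first derivatives extend continuously to the closed set; dm (resp. ux, ut)
   is the derivative (resp. are the partial derivatives) so extended. *)
Definition C1_seg (R : realType) (e M : R) (m dm : R -> R) : Prop :=
  [/\ {within `[e, M], continuous m},
      {within `[e, M], continuous dm} &
      forall x : R, x \in `]e, M[ -> is_derive x 1 m (dm x)].

Definition C1_rect (R : realType) (e M T : R) (u ux ut : R * R -> R) : Prop :=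
  [/\ {within crect e M T, continuous u},
      {within crect e M T, continuous ux},
      {within crect e M T, continuous ut} &
      forall z : R * R, orect e M T z ->
        is_derive z ((1, 0) : R * R) u (ux z) /\
        is_derive z ((0, 1) : R * R) u (ut z)].

Definition max_norm (R : realType) (A : Type) (D : set A) (f : A -> R) : R :=
  sup [set `|f z| | z in D].

Definition C1_norm (R : realType) (e M T : R) (g gx gt : R * R -> R) : R :=
  max_norm (crect e M T) g + max_norm (crect e M T) gx
    + max_norm (crect e M T) gt.

Definition L2 (d : measure_display) (A : measurableType d) (R : realType)
    (mu : {measure set A -> \bar R}) (D : set A) (f : A -> R) : Prop :=
  measurable_fun D f /\ mu.-integrable D (fun z => (f z ^+ 2)%:E).

(* Stated with extended-real integrals, so that an infinite L^2 distance is not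
   confused with a zero one. *)
Definition cvg_L2 (d : measure_display) (A : measurableType d) (R : realType)
    (mu : {measure set A -> \bar R}) (D : set A)
    (fn : nat -> A -> R) (f : A -> R) : Prop :=
  (fun n => \int[mu]_(z in D) ((fn n z - f z) ^+ 2)%:E)%E @ \oo --> 0%E.

(* C^1 functions with compact support in D, with their partial derivatives. *)
Definition test_fun (R : realType) (D : set (R * R))
    (phi phix phit : R * R -> R) : Prop :=
  [/\ continuous phi, continuous phix, continuous phit,
      forall z : R * R,
        is_derive z ((1, 0) : R * R) phi (phix z) /\
        is_derive z ((0, 1) : R * R) phi (phit z) &
      exists K : set (R * R),
        [/\ compact K, K `<=` D & forall z, ~ K z -> phi z = 0]].

Definition weak_derivs (R : realType) (D : set (R * R))
    (u ux ut : R * R -> R) : Prop :=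
  forall phi phix phit : R * R -> R, test_fun D phi phix phit ->
    \int[leb2 R]_(z in D) (u z * phix z)
      = - (\int[leb2 R]_(z in D) (ux z * phi z)) /\
    \int[leb2 R]_(z in D) (u z * phit z)
      = - (\int[leb2 R]_(z in D) (ut z * phi z)).

(* u belongs to H^1(D), with weak partial derivatives ux and ut. *)
Definition H1 (R : realType) (D : set (R * R)) (u ux ut : R * R -> R) : Prop :=
  [/\ L2 (leb2 R) D u, L2 (leb2 R) D ux, L2 (leb2 R) D ut &
      weak_derivs D u ux ut].

(* vxt serves as both mixed second derivatives: weak ones always commute. *)
Definition H2 (R : realType) (D : set (R * R))
    (v vx vt vxx vxt vtt : R * R -> R) : Prop :=
  [/\ H1 D v vx vt, H1 D vx vxx vxt & H1 D vt vxt vtt].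

(* h is the trace of u (in H^1, with weak derivatives ux and ut) on the side of
   the rectangle parametrized by gamma : I -> boundary: the L^2 limit on that
   side of the restrictions of functions which are C^1 up to the boundary and
   tend to u in H^1.  Such an h exists for each u in H^1 and is unique up to
   almost everywhere equality. *)
Definition is_trace (R : realType) (e M T : R) (I : set R)
    (gamma : R -> R * R) (u ux ut : R * R -> R) (h : R -> R) : Prop :=
  L2 (leb1 R) I h /\
  exists un unx unt : nat -> R * R -> R,
    [/\ forall n, C1_rect e M T (un n) (unx n) (unt n),
        cvg_L2 (leb2 R) (orect e M T) un u,
        cvg_L2 (leb2 R) (orect e M T) unx ux,
        cvg_L2 (leb2 R) (orect e M T) unt ut &
        cvg_L2 (leb1 R) I (fun n s => un n (gamma s)) h].

(* Trace on the side {a} x (0, T), for a = e or a = M. *)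
Definition trace_x (R : realType) (e M T a : R) (u ux ut : R * R -> R)
    (h : R -> R) : Prop :=
  is_trace e M T `]0, T[ (fun t => (a, t)) u ux ut h.

(* Trace on the side (e, M) x {b}, for b = 0 or b = T. *)
Definition trace_t (R : realType) (e M T b : R) (u ux ut : R * R -> R)
    (h : R -> R) : Prop :=
  is_trace e M T `]e, M[ (fun x => (x, b)) u ux ut h.

Record traces (R : realType) (e M T : R)
    (v vx vt vxx vxt vtt : R * R -> R)
    (v_e vx_e vt_e v_0 vx_0 v_T vx_T : R -> R) : Prop := Traces {
  trace_v_e : trace_x e M T e v vx vt v_e;
  trace_vx_e : trace_x e M T e vx vxx vxt vx_e;
  trace_vt_e : trace_x e M T e vt vxt vtt vt_e;
  trace_v_0 : trace_t e M T 0 v vx vt v_0;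
  trace_vx_0 : trace_t e M T 0 vx vxx vxt vx_0;
  trace_v_T : trace_t e M T T v vx vt v_T;
  trace_vx_T : trace_t e M T T vx vxx vxt vx_T }.

Definition coefficient (R : realType) (e M m0 m1 m2 : R) (m : R -> R) : Prop :=
  [/\ 0 < m0, m0 < m1,
      forall x : R, x \in `[e, M] -> m0 < m x < m1 &
      exists dm : R -> R, C1_seg e M m dm /\ m2 = max_norm `[e, M] dm].

Definition weight (R : realType) (lambda alpha : R) (z : R * R) : R :=
  expR (- (2 * lambda * (z.1 + alpha * z.2))).

Definition L0 (R : realType) (m : R -> R) (vxx vxt : R * R -> R)
    (z : R * R) : R :=
  vxx z - m z.1 * vxt z.

(* The right-hand side of the Carleman estimate; each occurrence of the generic
   constant has its own name. *)
Definition carleman_rhs (R : realType) (e M T lambda alpha : R)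
    (C1 C2 C3 C4 : R) (v vx vt : R * R -> R)
    (v_e vx_e vt_e v_0 vx_0 v_T vx_T : R -> R) : R :=
  C1 * lambda * (\int[leb2 R]_(z in orect e M T)
      (weight lambda alpha z *
        (vx z ^+ 2 + vt z ^+ 2 + lambda ^+ 2 * v z ^+ 2)))
  - C2 * lambda * (\int[leb1 R]_(t in `]0, T[)
      (weight lambda alpha (e, t) *
        (vx_e t ^+ 2 + lambda ^+ 2 * v_e t ^+ 2 + vt_e t ^+ 2)))
  + C3 * lambda * (\int[leb1 R]_(x in `]e, M[)
      (weight lambda alpha (x, 0) *
        (vx_0 x ^+ 2 + lambda ^+ 2 * v_0 x ^+ 2)))
  - C4 * lambda * (\int[leb1 R]_(x in `]e, M[)
      (weight lambda alpha (x, T) *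
        (vx_T x ^+ 2 + lambda ^+ 2 * v_T x ^+ 2))).

(* Main.v *)
Require Import Defs.
From HB Require Import structures.
From mathcomp Require Import all_boot all_order all_algebra.
From mathcomp Require Import all_classical all_reals all_analysis.
From mathcomp Require Import measurable_realfun ring lra.

Set Implicit Arguments.
Unset Strict Implicit.
Unset Printing Implicit Defensive.

Import Order.TTheory GRing.Theory Num.Theory.
Import numFieldNormedType.Exports.

Local Open Scope classical_set_scope.
Local Open Scope ring_scope.

(** The operator factors through first-order transport.  With p = v_x, s = v_t
    and q = v_x - m v_t,

      L_0 v = p_x - m p_t,   L_0 v = q_x + m' s,   q = v_x - m v_t,

    so that p, q and v are transported along the fields (1, -m), (1, 0) and
    (1, -m), with sources L_0 v, L_0 v - m' s and q.  For a transport operator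
    u_x - b u_t and the weight phi = exp (-2 lambda (x + alpha t)), the identity

      phi f^2 - (lambda/2) ((phi u^2)_x - (b phi u^2)_t)
        = phi ((f - lambda u / 2)^2 + lambda^2 (3/4 - alpha b) u^2),
      f = u_x - b u_t,

    has a right-hand side of at least lambda^2 phi u^2 / 4 as soon as
    alpha b <= 1/2.  Integrated over the rectangle it gives a Carleman estimate of
    order lambda^2 (lemma transport_C1): the side x = M has the favourable sign,
    and so has t = 0 when b > 0.

    Applied to p it bounds lambda^2 v_x^2 by (L_0 v)^2; applied to q, it bounds
    lambda^2 q^2, the term m' s being absorbed for lambda large because
    s = (p - q) / m; applied to v and multiplied by lambda^2, it bounds
    lambda^4 v^2 by lambda^2 q^2.  As s = (p - q) / m again, v_t is bounded too.
    The sum is lemma carleman_core.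

    For the second estimate, g v_xt v(x,0) is integrated by parts in t
    (lemma mixed_C1): what comes out are products of v_x and v(x,0), inside and on
    the sides t = 0 and t = T, of order at most lambda, absorbed by the gain in
    carleman_core once lambda is large.

    All this is proved for functions that are C^1 up to the boundary, where it is
    Fubini's theorem and the fundamental theorem of calculus.  The definition of a
    trace provides an approximating sequence of such functions, but a different one
    for each side.  The trace inequalities edge_x_le and edge_t_le show that the
    boundary values of one H^1 approximation converge to the traces on all the
    sides (lemma H1conv_edge), so that the estimates pass to the limit. *)

(** * Square-integrable functions on a measurable set *)

Lemma normM_le_half (R : realType) (a b : R) :
  `|a * b| <= (a ^+ 2 + b ^+ 2) / 2.
Proof.
rewrite normrM -(real_normK (num_real a)) -(real_normK (num_real b)).
have := sqr_ge0 (`|a| - `|b|); rewrite sqrrB; lra.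
Qed.

Section SquareIntegrable.
Context d (A : measurableType d) (R : realType).
Variables (mu : {measure set A -> \bar R}) (D : set A).
Hypothesis mD : measurable D.

(** The multipliers that act on L^2(D): the weight and the coefficients enter the
    limit arguments only through this property. *)
Definition bounded_mfun (w : A -> R) : Prop :=
  measurable_fun D w /\ exists K : R, forall z, D z -> `|w z| <= K.

Lemma bounded_mfun_cst c : bounded_mfun (fun=> c).
Proof. by split; [exact: measurable_cst|exists `|c|]. Qed.

Lemma bounded_mfunM w w' : bounded_mfun w -> bounded_mfun w' ->
  bounded_mfun (fun z => w z * w' z).
Proof.
move=> [mw [K hK]] [mw' [K' hK']]; split; first exact: measurable_funM.
exists (K * K') => z Dz; rewrite normrM.
by apply: ler_pM => //; [exact: hK|exact: hK'].
Qed.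

Lemma bounded_mfun_integrable w : (mu D < +oo)%E -> bounded_mfun w ->
  mu.-integrable D (EFin \o w).
Proof.
move=> muD [mw [K hK]]; apply: measurable_bounded_integrable => //.
exists K; split; first exact: num_real.
by move=> M KM z Dz /=; exact: le_trans (hK z Dz) (ltW KM).
Qed.

Lemma le_integrableR (f g : A -> R) : measurable_fun D f ->
  (forall z, D z -> `|f z| <= g z) -> mu.-integrable D (EFin \o g) ->
  mu.-integrable D (EFin \o f).
Proof.
move=> mf fg; apply: le_integrable => //; first exact/measurable_EFinP.
by move=> z Dz /=; rewrite lee_fin (le_trans (fg z Dz))// ler_norm.
Qed.

Lemma integrableRD (f g : A -> R) : mu.-integrable D (EFin \o f) ->
  mu.-integrable D (EFin \o g) ->
  mu.-integrable D (EFin \o (fun z => f z + g z)).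
Proof. by move=> f1 g1; exact: (integrableD mD f1 g1). Qed.

Lemma integrableRZ c (f : A -> R) : mu.-integrable D (EFin \o f) ->
  mu.-integrable D (EFin \o (fun z => c * f z)).
Proof. by move=> f1; exact: (integrableZl mD c f1). Qed.

Lemma integrableRB (f g : A -> R) : mu.-integrable D (EFin \o f) ->
  mu.-integrable D (EFin \o g) ->
  mu.-integrable D (EFin \o (fun z => f z - g z)).
Proof. by move=> f1 g1; exact: (integrableB mD f1 g1). Qed.

Lemma L2_bounded_mfun w : (mu D < +oo)%E -> bounded_mfun w -> L2 mu D w.
Proof.
move=> muD bw; split; first by case: bw.
by apply: (@bounded_mfun_integrable (fun z => w z ^+ 2)) => //; exact: bounded_mfunM.
Qed.

Lemma L2_integrable w f : bounded_mfun w -> L2 mu D f ->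
  mu.-integrable D (EFin \o (fun z => w z * f z ^+ 2)).
Proof.
move=> [mw [K hK]] [mf if2].
apply: (@le_integrableR _ (fun z => K * f z ^+ 2)).
- by apply: measurable_funM => //; exact: measurable_funX.
- move=> z Dz; rewrite normrM (@ger0_norm _ (f z ^+ 2)) ?sqr_ge0//.
  by apply: ler_wpM2r; [exact: sqr_ge0|exact: hK].
- exact: integrableRZ.
Qed.

Lemma L2D f g : L2 mu D f -> L2 mu D g -> L2 mu D (fun z => f z + g z).
Proof.
move=> [mf f2] [mg g2]; split; first exact: measurable_funD.
apply: (@le_integrableR _ (fun z => 2 * f z ^+ 2 + 2 * g z ^+ 2)).
- by apply: measurable_funX; exact: measurable_funD.
- move=> z Dz; rewrite ger0_norm ?sqr_ge0//.
  by have := sqr_ge0 (f z - g z); nra.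
- by apply: integrableRD; exact: integrableRZ.
Qed.

Lemma L2M w f : bounded_mfun w -> L2 mu D f -> L2 mu D (fun z => w z * f z).
Proof.
move=> bw [mf f2]; split; first by apply: measurable_funM => //; case: bw.
rewrite [X in _.-integrable _ X](_ : _ =
    EFin \o (fun z => (w z * w z) * f z ^+ 2)).
  by apply: L2_integrable => //; exact: bounded_mfunM.
by apply/funext => z /=; congr EFin; ring.
Qed.

Lemma L2N f : L2 mu D f -> L2 mu D (fun z => - f z).
Proof.
move=> Lf; rewrite (_ : (fun z => _) = fun z => (-1) * f z).
  by apply: L2M => //; exact: bounded_mfun_cst.
by apply/funext => z; rewrite mulN1r.
Qed.

Lemma L2_mul_integrable w f g : bounded_mfun w -> L2 mu D f -> L2 mu D g ->
  mu.-integrable D (EFin \o (fun z => w z * (f z * g z))).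
Proof.
move=> bw Lf Lg; apply: (@le_integrableR _
    (fun z => `|w z| * f z ^+ 2 + `|w z| * g z ^+ 2)).
- apply: measurable_funM; first by case: bw.
  by apply: measurable_funM; [case: Lf|case: Lg].
- move=> z Dz; rewrite -mulrDr normrM ler_wpM2l// ler_norml.
  by apply/andP; split; [have := sqr_ge0 (f z + g z)|have := sqr_ge0 (f z - g z)]; nra.
- have bnw : bounded_mfun (fun z => `|w z|).
    case: bw => mw [K hK]; split; first exact: measurableT_comp.
    by exists K => z Dz; rewrite normr_id; exact: hK.
  by apply: integrableRD; exact: L2_integrable.
Qed.

(** Unlike cvg_L2, this records that the functions are square integrable, so that
    the distance can be a real number and integrals can be split. *)
Definition L2conv (fn : nat -> A -> R) (f : A -> R) : Prop :=
  [/\ forall n, L2 mu D (fn n), L2 mu D f &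
      (fun n => \int[mu]_(z in D) (fn n z - f z) ^+ 2) @ \oo --> (0 : R)].

Lemma L2B f g : L2 mu D f -> L2 mu D g -> L2 mu D (fun z => f z - g z).
Proof. by move=> Lf Lg; apply: L2D => //; exact: L2N. Qed.

Lemma cvg_L2P fn f : (forall n, L2 mu D (fn n)) -> L2 mu D f ->
  cvg_L2 mu D fn f <->
  (fun n => \int[mu]_(z in D) (fn n z - f z) ^+ 2) @ \oo --> (0 : R).
Proof.
move=> Lfn Lf.
have E n : (\int[mu]_(z in D) ((fn n z - f z) ^+ 2)%:E)%E =
    (\int[mu]_(z in D) (fn n z - f z) ^+ 2)%:E.
  by rewrite /Rintegral fineK//; apply: integrable_fin_num => //;
    case: (L2B (Lfn n) Lf).
rewrite /cvg_L2; under eq_fun do rewrite E.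
by split=> [/fine_cvg//|c]; apply: cvg_EFin; [exact: nearW|].
Qed.

Lemma L2conv_bound fn f (e : nat -> R) : (forall n, L2 mu D (fn n)) ->
  L2 mu D f -> e @ \oo --> (0 : R) ->
  (forall n, \int[mu]_(z in D) (fn n z - f z) ^+ 2 <= e n) ->
  L2conv fn f.
Proof.
move=> Lfn Lf e0 le; split=> //.
apply: (squeeze_cvgr _ (cvg_cst 0) e0).
apply: nearW => n; rewrite le andbT.
by apply: Rintegral_ge0 => z _; exact: sqr_ge0.
Qed.

Lemma L2convD fn f gn g : L2conv fn f -> L2conv gn g ->
  L2conv (fun n z => fn n z + gn n z) (fun z => f z + g z).
Proof.
move=> [Lfn Lf cf] [Lgn Lg cg].
apply: (@L2conv_bound _ _ (fun n => 2 * (\int[mu]_(z in D) (fn n z - f z) ^+ 2)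
   + 2 * (\int[mu]_(z in D) (gn n z - g z) ^+ 2))).
- by move=> n; exact: L2D.
- exact: L2D.
- rewrite [X in _ --> X](_ : _ = 2 * 0 + 2 * 0); last by rewrite mulr0 addr0.
  by apply: cvgD; apply: cvgM => //; exact: cvg_cst.
- move=> n; have [_ i1] := L2B (Lfn n) Lf; have [_ i2] := L2B (Lgn n) Lg.
  rewrite -!RintegralZl// -RintegralD//; [|exact: integrableRZ..].
  apply: le_Rintegral => //.
  + by have [] := L2B (L2D (Lfn n) (Lgn n)) (L2D Lf Lg).
  + by apply: integrableRD; exact: integrableRZ.
  + by move=> z Dz; have := sqr_ge0 ((fn n z - f z) - (gn n z - g z)); nra.
Qed.

Lemma L2convM w fn f : bounded_mfun w -> L2conv fn f ->
  L2conv (fun n z => w z * fn n z) (fun z => w z * f z).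
Proof.
move=> bw [Lfn Lf cf]; have [mw [K hK]] := bw.
apply: (@L2conv_bound _ _
   (fun n => K ^+ 2 * (\int[mu]_(z in D) (fn n z - f z) ^+ 2))).
- by move=> n; exact: L2M.
- exact: L2M.
- rewrite [X in _ --> X](_ : _ = K ^+ 2 * 0); last by rewrite mulr0.
  by apply: cvgM => //; exact: cvg_cst.
- move=> n; have [_ i1] := L2B (Lfn n) Lf.
  rewrite -!RintegralZl//; apply: le_Rintegral => //.
  + by have [] := L2B (L2M bw (Lfn n)) (L2M bw Lf).
  + exact: integrableRZ.
  + move=> z Dz; rewrite -mulrBr exprMn; apply: ler_wpM2r; first exact: sqr_ge0.
    by rewrite -(real_normK (num_real (w z))) lerXn2r ?nnegrE//;
      [exact: le_trans (hK z Dz)|exact: hK].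
Qed.

Lemma L2convN fn f : L2conv fn f ->
  L2conv (fun n z => - fn n z) (fun z => - f z).
Proof.
move=> cf; have := L2convM (bounded_mfun_cst (-1)) cf.
by under [X in L2conv X _ -> _]eq_fun do under eq_fun do rewrite mulN1r;
   under [X in L2conv _ X -> _]eq_fun do rewrite mulN1r.
Qed.

Lemma L2conv_cst f : L2 mu D f -> L2conv (fun=> f) f.
Proof.
move=> Lf; apply: (@L2conv_bound _ _ (fun=> 0)) => // [|n]; first exact: cvg_cst.
by under eq_Rintegral do rewrite subrr expr0n /=; rewrite Rintegral_cst// mul0r.
Qed.

(** For every del > 0, |f_n^2 - f^2| <= (1 + 1/del) (f_n - f)^2 + del f^2: the first
    term tends to 0 in mean for fixed del, and del is arbitrary. *)
Lemma L2conv_quad w fn f : bounded_mfun w -> L2conv fn f ->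
  (fun n => \int[mu]_(z in D) (w z * fn n z ^+ 2)) @ \oo -->
  \int[mu]_(z in D) (w z * f z ^+ 2).
Proof.
move=> bw [Lfn Lf cf]; have [mw [K0 hK0]] := bw.
pose K := `|K0| + 1.
have K_gt0 : 0 < K by rewrite ltr_wpDl.
have hK z : D z -> `|w z| <= K.
  by move=> Dz; rewrite (le_trans (hK0 z Dz))// (le_trans (ler_norm _))// lerDl.
pose S := \int[mu]_(z in D) f z ^+ 2.
have S0 : 0 <= S by apply: Rintegral_ge0 => z _; exact: sqr_ge0.
have bound (del : R) n : 0 < del ->
    `|\int[mu]_(z in D) (w z * f z ^+ 2) - \int[mu]_(z in D) (w z * fn n z ^+ 2)|
    <= K * (1 + del^-1) * (\int[mu]_(z in D) (fn n z - f z) ^+ 2) + K * del * S.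
  move=> d0; have [_ i1] := L2B (Lfn n) Lf; have [_ i2] := Lf.
  have i3 := L2_integrable bw Lf; have i4 := L2_integrable bw (Lfn n).
  rewrite -RintegralB//.
  have i5 := integrableRB i3 i4.
  apply: (le_trans (le_normr_Rintegral mD i5)).
  rewrite -!RintegralZl// -RintegralD//; [|exact: integrableRZ..].
  apply: le_Rintegral => //.
  - by apply: integrable_norm => //.
  - by apply: integrableRD; exact: integrableRZ.
  - move=> z Dz; rewrite -mulrBr normrM -!mulrA -mulrDr.
    apply: ler_pM => //; first exact: hK.
    set a := fn n z; set b := f z.
    have h : 2 * `|b * (a - b)| <= del^-1 * (a - b) ^+ 2 + del * b ^+ 2.
      rewrite normrM -(real_normK (num_real (a - b))) -(real_normK (num_real b)).
      have := mulr_ge0 (ltW (_ : 0 < del^-1)) (sqr_ge0 (`|a - b| - del * `|b|)).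
      rewrite invr_gt0 => /(_ d0).
      rewrite (_ : del^-1 * _ ^+ 2 = del^-1 * `|a - b| ^+ 2 + del * `|b| ^+ 2 -
        2 * (`|b| * `|a - b|)) ?subr_ge0//.
      by field; rewrite gt_eqF.
    rewrite (_ : b ^+ 2 - a ^+ 2 = - ((a - b) ^+ 2 + 2 * (b * (a - b)))); last by ring.
    rewrite normrN; apply: (le_trans (ler_normD _ _)).
    have -> : `|2 * (b * (a - b))| = 2 * `|b * (a - b)|.
      by rewrite normrM ger0_norm.
    by rewrite ger0_norm ?sqr_ge0//; lra.
apply/cvgrPdist_le => e e0.
(* S + 1 instead of S, which may vanish; del makes K del S at most e / 2. *)
pose del := e / (2 * K * (S + 1)).
have S1 : 0 < S + 1 by rewrite ltr_wpDl.
have del0 : 0 < del by rewrite divr_gt0// !mulr_gt0.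
have hd : K * del * S <= e / 2.
  rewrite /del (_ : K * _ * S = e / 2 * (S / (S + 1))); last first.
    by field; rewrite !gt_eqF.
  apply: ler_piMr; first by rewrite divr_ge0// ltW.
  by rewrite ler_pdivrMr// mul1r; lra.
pose c := K * (1 + del^-1).
have c0 : 0 < c by rewrite mulr_gt0// addr_gt0// invr_gt0.
have /cvgrPdist_le /(_ (e / 2 / c)) := cf.
have ec : 0 < e / 2 / c by rewrite !divr_gt0.
move=> /(_ ec); apply: filterS => n.
rewrite sub0r normrN ger0_norm; last by apply: Rintegral_ge0 => z _; exact: sqr_ge0.
rewrite ler_pdivlMr// mulrC => hn.
apply: (le_trans (bound del n del0)); rewrite -/c; lra.
Qed.

(** By polarization, the product is a difference of two squares. *)
Lemma L2conv_bilin w fn f k : bounded_mfun w -> L2conv fn f -> L2 mu D k ->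
  (fun n => \int[mu]_(z in D) (w z * (fn n z * k z))) @ \oo -->
  \int[mu]_(z in D) (w z * (f z * k z)).
Proof.
move=> bw cf Lk.
have E (h : A -> R) : L2 mu D h -> \int[mu]_(z in D) (w z * (h z * k z)) =
   4^-1 * (\int[mu]_(z in D) (w z * (h z + k z) ^+ 2)
     - \int[mu]_(z in D) (w z * (h z - k z) ^+ 2)).
  move=> Lh.
  have i1 := L2_integrable bw (L2D Lh Lk); have i2 := L2_integrable bw (L2B Lh Lk).
  rewrite -RintegralB// -RintegralZl//; last exact: integrableRB.
  by apply: eq_Rintegral => z _; field.
have [Lfn Lf _] := cf.
under eq_fun do rewrite E//.
rewrite E//; apply: cvgM; first exact: cvg_cst.
apply: cvgB; apply: L2conv_quad => //.
- by apply: L2convD => //; exact: L2conv_cst.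
- by apply: L2convD => //; apply: L2conv_cst; exact: L2N.
Qed.

End SquareIntegrable.

(** * Measurability, integration and Fubini's theorem in the plane *)

Lemma within_comp (U V W : topologicalType) (A : set U) (B : set V)
    (h : U -> V) (f : V -> W) : continuous h -> (forall x, A x -> B (h x)) ->
  {within B, continuous f} -> {within A, continuous (fun x => f (h x))}.
Proof.
move=> ch AB /subspace_continuousP cf; apply/subspace_continuousP => x Ax.
have hAB : h @ within A (nbhs x) --> within B (nbhs (h x)).
  move=> P /= BP; have := ch x _ BP; rewrite /nbhs /= => hP.
  by near_simpl; apply: filterS hP => y hy Ay; apply: hy; exact: AB.
exact: cvg_comp hAB (cf _ (AB _ Ax)).
Qed.

Section Plane.
Variable R : realType.

(** Measurable sets of the plane are generated by measurable boxes, and an open set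
    is the countable union of the boxes with rational corners that it contains. *)
Lemma open_plane_measurable (U : set (R * R)) : open U -> measurable U.
Proof.
move=> oU.
pose box (q : (rat * rat) * (rat * rat)) : set (R * R) :=
  `]ratr q.1.1, ratr q.1.2[%classic `*` `]ratr q.2.1, ratr q.2.2[%classic.
pose F q := [set z | box q `<=` U /\ box q z].
rewrite (_ : U = \bigcup_q F q).
  apply: countable_bigcupT_measurable => [|q]; first exact: countableP.
  have [sub|nsub] := pselect (box q `<=` U).
    rewrite (_ : F q = box q); first by apply: measurableX; exact: measurable_itv.
    by apply/seteqP; split => z; [case|].
  rewrite (_ : F q = set0); first exact: measurable0.
  by apply/seteqP; split => z // [].
apply/seteqP; split => [z Uz|z [q _ [sub /sub]]//].
have : nbhs z U by exact: open_nbhs_nbhs.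
rewrite -nbhs_ballE => -[r /= r0 rU].
have itv (x : R) : exists q : rat * rat, [/\ x - r < ratr q.1, ratr q.1 < x,
    x < ratr q.2 & ratr q.2 < x + r].
  have /rat_in_itvoo [q] : x - r < x by rewrite ltrBlDr ltrDl.
  have /rat_in_itvoo [q'] : x < x + r by rewrite ltrDl.
  rewrite !in_itv /= => /andP[h1 h2] /andP[h3 h4].
  by exists (q, q').
have [q1 [a1 a2 a3 a4]] := itv z.1; have [q2 [b1 b2 b3 b4]] := itv z.2.
exists (q1, q2) => //; split; last by split; rewrite /= in_itv /=; apply/andP.
move=> y [] /=; rewrite !in_itv /= => /andP[c1 c2] /andP[c3 c4].
by apply: rU; split; rewrite /ball /= ltr_norml; apply/andP; split; lra.
Qed.

(** The open interval is where the derivative is given; the values at the end points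
    make sense because both functions extend continuously. *)
Lemma FTC_oo (f F : R -> R) (a b : R) : a < b ->
  {within `[a, b], continuous f} -> {within `[a, b], continuous F} ->
  (forall x, x \in `]a, b[ -> is_derive x 1 F (f x)) ->
  (\int[@lebesgue_measure R]_(x in `]a, b[) (f x)%:E)%E = (F b - F a)%:E.
Proof.
move=> ab cf cF dF.
rewrite -(@integral_itv_bndoo _ a b _ true false); last first.
  apply/measurable_EFinP; apply: subspace_continuous_measurable_fun => //.
  by apply: continuous_subspaceW cf; exact: subset_itv_oo_cc.
rewrite (continuous_FTC2 (F := F))//.
- have [_ ca cb] := (continuous_within_itvP F ab).1 cF.
  by split => // x xab; have := dF x xab.
- by move=> x xab; rewrite derive1E; have ? := dF x xab; exact: derive_val.
Qed.

End Plane.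

Section ProductIntegral.
Context d1 d2 (T1 : measurableType d1) (T2 : measurableType d2) (R : realType).
Variables (m1 : {sigma_finite_measure set T1 -> \bar R})
          (m2 : {sigma_finite_measure set T2 -> \bar R}).
Variables (D1 : set T1) (D2 : set T2) (F : T1 * T2 -> R).
Hypotheses (mD1 : measurable D1) (mD2 : measurable D2).

(** Fubini's theorem for an inner integral whose finite value H y is known for every
    y, as is the case when the fundamental theorem of calculus computes it. *)
Lemma Rintegral_setX21 (H : T2 -> R) :
  (m1 \x m2)%E.-integrable (D1 `*` D2) (EFin \o F) ->
  (forall y, D2 y -> (\int[m1]_(x in D1) (F (x, y))%:E)%E = (H y)%:E) ->
  \int[(m1 \x m2)%E]_(z in D1 `*` D2) F z = \int[m2]_(y in D2) H y.
Proof.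
move=> iF FH; congr fine; rewrite integral_mkcond -integral21_prod_meas1; last first.
  by apply/(integrable_mkcond (EFin \o F)) => //; exact: measurableX.
rewrite [RHS]integral_mkcond; apply: eq_integral => y _; rewrite /fubini_G patchE.
case: ifPn => yD.
  rewrite -FH ?inE//; last by move: yD; rewrite inE.
  rewrite [RHS]integral_mkcond; apply: eq_integral => x _.
  by rewrite !patchE in_setX yD andbT.
by rewrite integral0_eq// => x _; rewrite patchE in_setX (negbTE yD) andbF.
Qed.

Lemma Rintegral_setX12 (H : T1 -> R) :
  (m1 \x m2)%E.-integrable (D1 `*` D2) (EFin \o F) ->
  (forall x, D1 x -> (\int[m2]_(y in D2) (F (x, y))%:E)%E = (H x)%:E) ->
  \int[(m1 \x m2)%E]_(z in D1 `*` D2) F z = \int[m1]_(x in D1) H x.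
Proof.
move=> iF FH; congr fine; rewrite integral_mkcond -integral12_prod_meas1; last first.
  by apply/(integrable_mkcond (EFin \o F)) => //; exact: measurableX.
rewrite [RHS]integral_mkcond; apply: eq_integral => x _; rewrite /fubini_F patchE.
case: ifPn => xD.
  rewrite -FH ?inE//; last by move: xD; rewrite inE.
  rewrite [RHS]integral_mkcond; apply: eq_integral => y _.
  by rewrite !patchE in_setX xD.
by rewrite integral0_eq// => y _; rewrite patchE in_setX (negbTE xD).
Qed.

End ProductIntegral.

(** * Continuous functions on the closed rectangle *)

Lemma compact_continuous_bounded (R : realType) (U : topologicalType)
    (D : set U) (f : U -> R) : compact D -> {within D, continuous f} ->
  exists K : R, forall z, D z -> `|f z| <= K.
Proof.
move=> cD cf; have /compact_bounded [K [_ hK]] := continuous_compact cf cD.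
by exists (K + 1) => z Dz; apply: (hK (K + 1)); [rewrite ltrDl|exists z].
Qed.

Section Rectangle.
Variables (R : realType) (e M T : R).
Hypotheses (eM : e < M) (T0 : 0 < T).
Implicit Types u w : R * R -> R.

Definition rect_continuous u : Prop := {within crect e M T, continuous u}.

Lemma rect_continuousD u w : rect_continuous u -> rect_continuous w ->
  rect_continuous (fun z => u z + w z).
Proof. by move=> cu cw z; apply: cvgD; [exact: cu|exact: cw]. Qed.

Lemma rect_continuousM u w : rect_continuous u -> rect_continuous w ->
  rect_continuous (fun z => u z * w z).
Proof. by move=> cu cw z; apply: cvgM; [exact: cu|exact: cw]. Qed.

Lemma rect_continuousN u : rect_continuous u -> rect_continuous (fun z => - u z).
Proof. by move=> cu z; apply: cvgN; exact: cu. Qed.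

Lemma rect_continuousB u w : rect_continuous u -> rect_continuous w ->
  rect_continuous (fun z => u z - w z).
Proof. by move=> cu cw; apply: rect_continuousD => //; exact: rect_continuousN. Qed.

Lemma rect_continuousX u : rect_continuous u -> rect_continuous (fun z => u z ^+ 2).
Proof. exact: (fun cu => rect_continuousM cu cu). Qed.

Lemma rect_continuous_cst c : rect_continuous (fun=> c).
Proof. by move=> z; exact: cvg_cst. Qed.

Lemma rect_continuousT u : continuous u -> rect_continuous u.
Proof. exact: continuous_subspaceT. Qed.

Lemma rect_continuous_fst (m : R -> R) : {within `[e, M], continuous m} ->
  rect_continuous (fun z => m z.1).
Proof.
apply: (within_comp (h := fst)); first by move=> z; exact: cvg_fst.
by move=> z [].
Qed.

Lemma rect_continuous_slice_x u t : t \in `[0, T] -> rect_continuous u ->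
  {within `[e, M], continuous (fun x => u (x, t))}.
Proof.
move=> t0T; apply: (within_comp (h := fun x => (x, t))).
  move=> x; apply: (@cvg_pair _ _ _ _ (nbhs x) (nbhs t)); first exact: cvg_id.
  exact: cvg_cst.
by move=> x xeM; split.
Qed.

Lemma rect_continuous_slice_t u x : x \in `[e, M] -> rect_continuous u ->
  {within `[0, T], continuous (fun t => u (x, t))}.
Proof.
move=> xeM; apply: (within_comp (h := fun t => (x, t))).
  move=> t; apply: (@cvg_pair _ _ _ _ (nbhs x) (nbhs t)); last exact: cvg_id.
  exact: cvg_cst.
by move=> t t0T; split.
Qed.

Lemma orect_sub : orect e M T `<=` crect e M T.
Proof.
by move=> z [/= z1 z2]; split; rewrite /=; exact: subset_itv_oo_cc.
Qed.

Lemma compact_crect : compact (crect e M T).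
Proof. by apply: compact_setX; exact: segment_compact. Qed.

Lemma measurable_orect : measurable (orect e M T).
Proof. by apply: measurableX; exact: measurable_itv. Qed.

Lemma open_orect : open (orect e M T).
Proof.
rewrite openE => z [/= z1 z2]; exists (`]e, M[%classic, `]0, T[%classic) => //=.
by split; apply: open_nbhs_nbhs; split => //; exact: interval_open.
Qed.

Lemma leb1_oo_lty (a b : R) : (leb1 R `]a, b[%classic < +oo)%E.
Proof.
rewrite /leb1 lebesgue_measure_itv /=; case: ifP => // _.
by rewrite -EFinB ltry.
Qed.

Lemma leb2_orect_lty : (leb2 R (orect e M T) < +oo)%E.
Proof.
rewrite /leb2 /orect product_measure1E; [|exact: measurable_itv..].
by apply: lte_mul_pinfty => //; [rewrite ge0_fin_numE//|]; exact: leb1_oo_lty.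
Qed.

Lemma rect_continuous_bounded_mfun u : rect_continuous u -> bounded_mfun (orect e M T) u.
Proof.
move=> cu; split.
  move=> mD; apply: (measurability _ (RGenOpens.measurableE R)) => //.
  move=> _ [_ [a [b ->] <-]]; apply: open_plane_measurable.
  have : {within orect e M T, continuous u}.
    by apply: continuous_subspaceW cu; exact: orect_sub.
  rewrite continuous_open_subspace; last exact: open_orect.
  move=> cu'; rewrite openE => z [Dz uz].
  apply: filterI; first by apply: open_nbhs_nbhs; split => //; exact: open_orect.
  have Dz' : z \in orect e M T by rewrite inE.
  apply: (cu' z Dz'); apply: open_nbhs_nbhs; split => //; exact: interval_open.
have [K hK] := compact_continuous_bounded compact_crect cu.
by exists K => z /orect_sub; exact: hK.
Qed.

Lemma itv_bounded_mfun (a b : R) (h : R -> R) : {within `[a, b], continuous h} ->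
  bounded_mfun `]a, b[%classic h.
Proof.
move=> ch; split.
  apply: subspace_continuous_measurable_fun => //.
  by apply: continuous_subspaceW ch; exact: subset_itv_oo_cc.
have [K hK] := compact_continuous_bounded (@segment_compact R a b) ch.
by exists K => z Dz; apply: hK; exact: subset_itv_oo_cc.
Qed.

Lemma rect_continuous_integrable u : rect_continuous u ->
  (leb2 R).-integrable (orect e M T) (EFin \o u).
Proof.
move=> cu; apply: bounded_mfun_integrable.
- exact: measurable_orect.
- exact: leb2_orect_lty.
- exact: rect_continuous_bounded_mfun.
Qed.

Lemma itv_integrable (a b : R) (h : R -> R) : {within `[a, b], continuous h} ->
  (leb1 R).-integrable `]a, b[ (EFin \o h).
Proof.
move=> ch; apply: bounded_mfun_integrable.
- exact: measurable_itv.
- exact: leb1_oo_lty.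
- exact: itv_bounded_mfun.
Qed.

(** Restricted to lines parallel to the axes, partial derivatives obey the calculus
    of functions of one variable. *)
Definition slice_dx u ux : Prop := forall z, orect e M T z ->
  is_derive z.1 (1 : R) (fun x => u (x, z.2)) (ux z).

Definition slice_dt u ut : Prop := forall z, orect e M T z ->
  is_derive z.2 (1 : R) (fun t => u (z.1, t)) (ut z).

(** The fundamental theorem of calculus on each horizontal segment, integrated
    over t. *)
Lemma divergence_x u ux : rect_continuous u -> rect_continuous ux -> slice_dx u ux ->
  \int[leb2 R]_(z in orect e M T) ux z =
  \int[leb1 R]_(t in `]0, T[) (u (M, t) - u (e, t)).
Proof.
move=> cu cux du; apply: Rintegral_setX21.
- exact: measurable_itv.
- exact: measurable_itv.
- exact: rect_continuous_integrable.
- move=> t /= t0T; have t0T' := subset_itv_oo_cc t0T.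
  apply: (FTC_oo eM (rect_continuous_slice_x t0T' cux) (rect_continuous_slice_x t0T' cu)).
  by move=> x xeM; exact: (du (x, t)).
Qed.

Lemma divergence_t u ut : rect_continuous u -> rect_continuous ut -> slice_dt u ut ->
  \int[leb2 R]_(z in orect e M T) ut z =
  \int[leb1 R]_(x in `]e, M[) (u (x, T) - u (x, 0)).
Proof.
move=> cu cut du; apply: Rintegral_setX12.
- exact: measurable_itv.
- exact: measurable_itv.
- exact: rect_continuous_integrable.
- move=> x /= xeM; have xeM' := subset_itv_oo_cc xeM.
  apply: (FTC_oo T0 (rect_continuous_slice_t xeM' cut) (rect_continuous_slice_t xeM' cu)).
  by move=> t t0T; exact: (du (x, t)).
Qed.

Lemma is_derive_slice_x u a z : is_derive z ((1, 0) : R * R) u a ->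
  is_derive z.1 (1 : R) (fun x => u (x, z.2)) a.
Proof.
case: z => x t /= [du <-]; have E : (fun h : R => h^-1 *:
     (((fun x' => u (x', t)) \o shift x) (h *: (1 : R)) - u (x, t))) =
   (fun h : R => h^-1 *: ((u \o shift (x, t)) (h *: ((1, 0) : R * R)) - u (x, t))).
  apply/funext => h /=; congr (_ *: (u _ - _)).
  by rewrite /shift /=; congr pair; rewrite /= ?scaler0 ?add0r.
by split; [rewrite /derivable E|rewrite /derive E].
Qed.

Lemma is_derive_slice_t u a z : is_derive z ((0, 1) : R * R) u a ->
  is_derive z.2 (1 : R) (fun t => u (z.1, t)) a.
Proof.
case: z => x t /= [du <-]; have E : (fun h : R => h^-1 *:
     (((fun t' => u (x, t')) \o shift t) (h *: (1 : R)) - u (x, t))) =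
   (fun h : R => h^-1 *: ((u \o shift (x, t)) (h *: ((0, 1) : R * R)) - u (x, t))).
  apply/funext => h /=; congr (_ *: (u _ - _)).
  by rewrite /shift /=; congr pair; rewrite /= ?scaler0 ?add0r.
by split; [rewrite /derivable E|rewrite /derive E].
Qed.

End Rectangle.

(** * Derivatives along the axes and the Carleman weight *)

Section SliceCalculus.
Variables (R : realType) (e M T : R).
Implicit Types u w : R * R -> R.

Lemma slice_dxM u ux w wx : slice_dx e M T u ux -> slice_dx e M T w wx ->
  slice_dx e M T (fun z => u z * w z) (fun z => ux z * w z + u z * wx z).
Proof.
move=> du dw z Dz; have du' := du z Dz; have dw' := dw z Dz.
apply: (is_derive_eq (is_deriveM du' dw')).
by case: z {Dz du' dw'} => x t /=; rewrite /GRing.scale /=; ring.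
Qed.

Lemma slice_dtM u ut w wt : slice_dt e M T u ut -> slice_dt e M T w wt ->
  slice_dt e M T (fun z => u z * w z) (fun z => ut z * w z + u z * wt z).
Proof.
move=> du dw z Dz; have du' := du z Dz; have dw' := dw z Dz.
apply: (is_derive_eq (is_deriveM du' dw')).
by case: z {Dz du' dw'} => x t /=; rewrite /GRing.scale /=; ring.
Qed.

Lemma slice_dxB u ux w wx : slice_dx e M T u ux -> slice_dx e M T w wx ->
  slice_dx e M T (fun z => u z - w z) (fun z => ux z - wx z).
Proof.
move=> du dw z Dz; have du' := du z Dz; have dw' := dw z Dz.
exact: (is_deriveB du' dw').
Qed.

Lemma slice_dtB u ut w wt : slice_dt e M T u ut -> slice_dt e M T w wt ->
  slice_dt e M T (fun z => u z - w z) (fun z => ut z - wt z).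
Proof.
move=> du dw z Dz; have du' := du z Dz; have dw' := dw z Dz.
exact: (is_deriveB du' dw').
Qed.

Lemma slice_dt_fst (m : R -> R) : slice_dt e M T (fun z => m z.1) (fun=> 0).
Proof. by move=> z _ /=; exact: is_derive_cst. Qed.

Lemma slice_dx_fst (m dm : R -> R) :
  (forall x, x \in `]e, M[ -> is_derive x (1 : R) m (dm x)) ->
  slice_dx e M T (fun z => m z.1) (fun z => dm z.1).
Proof. by move=> dmE z [/= z1 _]; exact: dmE. Qed.

Lemma slice_dx_affine (c a : R) :
  slice_dx e M T (fun z => c * (z.1 - a)) (fun=> c).
Proof.
move=> z _ /=; apply: is_derive_eq.
by rewrite /GRing.scale /=; ring.
Qed.

Lemma slice_dt_affine (c a : R) :
  slice_dt e M T (fun z => c * (z.2 - a)) (fun=> c).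
Proof.
move=> z _ /=; apply: is_derive_eq.
by rewrite /GRing.scale /=; ring.
Qed.

Variables lambda alpha : R.
Notation phi := (weight lambda alpha).

Lemma weight_gt0 z : 0 < phi z. Proof. exact: expR_gt0. Qed.

Lemma weight_ge0 z : 0 <= phi z. Proof. exact: expR_ge0. Qed.

Lemma continuous_weight : continuous phi.
Proof.
move=> z; apply: (@cvg_comp _ _ _
  (fun z : R * R => - (2 * lambda * (z.1 + alpha * z.2))) expR);
  last exact: continuous_expR.
apply: cvgN; apply: cvgM; first exact: cvg_cst.
apply: cvgD; first exact: cvg_fst.
by apply: cvgM; [exact: cvg_cst|exact: cvg_snd].
Qed.

Lemma rect_continuous_weight : rect_continuous e M T phi.
Proof. by apply: rect_continuousT; exact: continuous_weight. Qed.

Lemma slice_dx_weight : slice_dx e M T phi (fun z => - (2 * lambda) * phi z).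
Proof.
move=> z _; rewrite /weight /=; apply: is_derive_eq.
by rewrite /GRing.scale /=; ring.
Qed.

Lemma slice_dt_weight :
  slice_dt e M T phi (fun z => - (2 * lambda * alpha) * phi z).
Proof.
move=> z _; rewrite /weight /=; apply: is_derive_eq.
by rewrite /GRing.scale /=; ring.
Qed.

End SliceCalculus.

(** * The transport inequality and trace inequalities for C^1 functions *)

(* The head symbol chooses the lemma: plain unification would unfold the operations
   of the real field. *)
Ltac rect_continuity :=
  lazymatch goal with
  | |- rect_continuous _ _ _ (fun z => @Algebra.add _ (@?u z) (@?w z)) =>
      apply: rect_continuousD; rect_continuity
  | |- rect_continuous _ _ _ (fun z => @Algebra.opp _ (@?u z)) =>
      apply: rect_continuousN; rect_continuity
  | |- rect_continuous _ _ _ (fun z => @GRing.mul _ (@?u z) (@?w z)) =>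
      apply: rect_continuousM; rect_continuity
  | |- rect_continuous _ _ _ (fun z => @GRing.exp _ (@?u z) _) =>
      apply: rect_continuousX; rect_continuity
  | |- rect_continuous _ _ _ (@fst _ _) => apply: rect_continuousT => ?; exact: cvg_fst
  | |- rect_continuous _ _ _ (@snd _ _) => apply: rect_continuousT => ?; exact: cvg_snd
  | |- rect_continuous _ _ _ (fun _ => ?c) => exact: rect_continuous_cst
  | _ => assumption
  end.

Section TransportC1.
Variables (R : realType) (e M T : R).
Hypotheses (eM : e < M) (T0 : 0 < T).
Implicit Types u w p : R * R -> R.

Lemma C1_rect_slices u ux ut : C1_rect e M T u ux ut ->
  slice_dx e M T u ux /\ slice_dt e M T u ut.
Proof.
move=> [_ _ _ du]; split => z /du [dx dt].
  exact: is_derive_slice_x.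
exact: is_derive_slice_t.
Qed.

Lemma C1_rectB u ux ut w wx wt : C1_rect e M T u ux ut -> C1_rect e M T w wx wt ->
  C1_rect e M T (fun z => u z - w z) (fun z => ux z - wx z) (fun z => ut z - wt z).
Proof.
move=> [cu cux cut du] [cw cwx cwt dw]; split; try exact: rect_continuousB.
move=> z Dz; have [d1 d2] := du z Dz; have [d3 d4] := dw z Dz.
by split; [exact: (is_deriveB d1 d3)|exact: (is_deriveB d2 d4)].
Qed.

Lemma edge_x_integrable u a : a \in `[e, M] -> rect_continuous e M T u ->
  (leb1 R).-integrable `]0, T[ (EFin \o (fun t => u (a, t))).
Proof. by move=> aeM cu; apply: itv_integrable; exact: rect_continuous_slice_t aeM cu. Qed.

Lemma edge_t_integrable u a : a \in `[0, T] -> rect_continuous e M T u ->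
  (leb1 R).-integrable `]e, M[ (EFin \o (fun x => u (x, a))).
Proof. by move=> a0T cu; apply: itv_integrable; exact: rect_continuous_slice_x a0T cu. Qed.

Let e_in : e \in `[e, M]. Proof. by rewrite in_itv /= lexx ltW. Qed.
Let M_in : M \in `[e, M]. Proof. by rewrite in_itv /= lexx ltW. Qed.
Let O_in : 0 \in `[0, T]. Proof. by rewrite in_itv /= lexx ltW. Qed.
Let T_in : T \in `[0, T]. Proof. by rewrite in_itv /= lexx ltW. Qed.
Let mO : measurable (orect e M T). Proof. exact: measurable_orect. Qed.

(** With f = px - b pt, the integrand satisfies
    phi f^2 - (lambda/2) ((phi p^2)_x - (b phi p^2)_t)
      = phi ((f - lambda p / 2)^2 + lambda^2 (3/4 - alpha b) p^2),
    and 3/4 - alpha b >= 1/4.  The side x = M, of favourable sign, is dropped; b is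
    bounded below where its sign helps (t = 0) and above where it does not (t = T).
    As the multiplier lambda/2 is constant, no derivative of b appears. *)
Lemma transport_C1 (lambda alpha : R) (b : R -> R) (b0 b1 : R) p px pt :
  0 <= lambda -> 0 <= alpha -> alpha * b1 <= 2^-1 ->
  {within `[e, M], continuous b} ->
  (forall x, x \in `[e, M] -> b0 <= b x <= b1) ->
  rect_continuous e M T p -> rect_continuous e M T px -> rect_continuous e M T pt ->
  slice_dx e M T p px -> slice_dt e M T p pt ->
  lambda ^+ 2 / 4 * (\int[leb2 R]_(z in orect e M T)
     (weight lambda alpha z * p z ^+ 2))
  + lambda / 2 * b0 * (\int[leb1 R]_(x in `]e, M[)
     (weight lambda alpha (x, 0) * p (x, 0) ^+ 2)) <=
  \int[leb2 R]_(z in orect e M T)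
     (weight lambda alpha z * (px z - b z.1 * pt z) ^+ 2)
  + lambda / 2 * (\int[leb1 R]_(t in `]0, T[)
     (weight lambda alpha (e, t) * p (e, t) ^+ 2))
  + lambda / 2 * b1 * (\int[leb1 R]_(x in `]e, M[)
     (weight lambda alpha (x, T) * p (x, T) ^+ 2)).
Proof.
move=> l0 a0 ab1 cb bb cp cpx cpt dpx dpt.
set phi := weight lambda alpha.
have cphi : rect_continuous e M T phi by exact: rect_continuous_weight.
have cbz : rect_continuous e M T (fun z => b z.1) by exact: rect_continuous_fst.
(* The two components phi p^2 and b phi p^2 of the field whose divergence is
   integrated; the factor 0 in Vt is the t-derivative of b. *)
pose U z := phi z * (p z * p z).
pose Ux z := - (2 * lambda) * phi z * (p z * p z) + phi z * (px z * p z + p z * px z).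
pose V z := b z.1 * (phi z * (p z * p z)).
pose Vt z := 0 * (phi z * (p z * p z)) + b z.1 * (- (2 * lambda * alpha) * phi z * (p z * p z)
   + phi z * (pt z * p z + p z * pt z)).
have cU : rect_continuous e M T U by rewrite /U; rect_continuity.
have cUx : rect_continuous e M T Ux by rewrite /Ux; rect_continuity.
have cV : rect_continuous e M T V by rewrite /V; rect_continuity.
have cVt : rect_continuous e M T Vt by rewrite /Vt; rect_continuity.
have dU : slice_dx e M T U Ux.
  by apply: slice_dxM; [exact: slice_dx_weight|exact: slice_dxM].
have dV : slice_dt e M T V Vt.
  apply: slice_dtM; first exact: slice_dt_fst.
  by apply: slice_dtM; [exact: slice_dt_weight|exact: slice_dtM].
have DU := divergence_x eM cU cUx dU.
have DV := divergence_t T0 cV cVt dV.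
have iU := rect_continuous_integrable cUx; have iV := rect_continuous_integrable cVt.
have cf : rect_continuous e M T (fun z => phi z * (px z - b z.1 * pt z) ^+ 2)
  by rect_continuity.
have cpp : rect_continuous e M T (fun z => phi z * p z ^+ 2) by rect_continuity.
have if2 := rect_continuous_integrable cf; have ip2 := rect_continuous_integrable cpp.
have main : lambda ^+ 2 / 4 * (\int[leb2 R]_(z in orect e M T) (phi z * p z ^+ 2))
   + lambda / 2 * (\int[leb2 R]_(z in orect e M T) Ux z
     - \int[leb2 R]_(z in orect e M T) Vt z) <=
   \int[leb2 R]_(z in orect e M T) (phi z * (px z - b z.1 * pt z) ^+ 2).
  rewrite -RintegralB// -!RintegralZl//; last exact: integrableRB.
  rewrite -RintegralD//; first last.
  - by apply: integrableRZ => //; exact: integrableRB.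
  - exact: integrableRZ.
  apply: le_Rintegral => //.
    by apply: integrableRD => //; apply: integrableRZ => //; exact: integrableRB.
  move=> z [/= z1 _]; rewrite /Ux /Vt.
  have /andP[hb0 hb1] := bb _ (subset_itv_oo_cc z1).
  have ab : alpha * b z.1 <= 2^-1 by apply: le_trans ab1; exact: ler_wpM2l.
  have ph0 : 0 < phi z by exact: weight_gt0.
  rewrite -subr_ge0 [X in 0 <= X](_ : _ = phi z *
     ((px z - b z.1 * pt z - lambda / 2 * p z) ^+ 2
      + (lambda * p z) ^+ 2 * (2^-1 - alpha * b z.1))); last by field.
  apply: mulr_ge0; first exact: ltW.
  by rewrite addr_ge0 ?sqr_ge0// mulr_ge0 ?sqr_ge0// subr_ge0.
have bdU : - (\int[leb1 R]_(t in `]0, T[) (phi (e, t) * p (e, t) ^+ 2)) <=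
    \int[leb1 R]_(t in `]0, T[) (U (M, t) - U (e, t)).
  rewrite RintegralB//; [|exact: edge_x_integrable..].
  rewrite [X in _ <= _ - X](_ : _ =
    \int[leb1 R]_(t in `]0, T[) (phi (e, t) * p (e, t) ^+ 2)) ?lerDr//.
  apply: Rintegral_ge0 => t _.
  by rewrite mulr_ge0 ?weight_ge0// -expr2 sqr_ge0.
have iT := edge_t_integrable T_in cpp; have i0 := edge_t_integrable O_in cpp.
have bdV : \int[leb1 R]_(x in `]e, M[) (V (x, T) - V (x, 0)) <=
    b1 * (\int[leb1 R]_(x in `]e, M[) (phi (x, T) * p (x, T) ^+ 2))
    - b0 * (\int[leb1 R]_(x in `]e, M[) (phi (x, 0) * p (x, 0) ^+ 2)).
  rewrite -!RintegralZl// -RintegralB//; [|exact: integrableRZ..].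
  apply: le_Rintegral => //.
  - by apply: integrableRB => //; exact: edge_t_integrable.
  - by apply: integrableRB => //; exact: integrableRZ.
  - move=> x /= xeM; have /andP[hb0 hb1] := bb _ (subset_itv_oo_cc xeM).
    rewrite /V /= -!expr2; apply: lerB; apply: ler_wpM2r => //;
    by rewrite mulr_ge0 ?weight_ge0 ?sqr_ge0.
move: main; rewrite DU DV => main.
have l2 : 0 <= lambda / 2 by rewrite divr_ge0.
have := lerD (ler_wpM2l l2 bdU) (ler_wpM2l l2 bdV).
move: main.
do ![set I := Rintegral _ _ _; move: I => ?]; clear; lra.
Qed.

(** Integrate the x-derivative of l w^2 for the affine function l equal to -1 at e
    and 0 at M: only the side x = e survives, and |2 l w w_x| <= w^2 + w_x^2. *)
Lemma edge_x_le w wx wt : C1_rect e M T w wx wt ->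
  \int[leb1 R]_(t in `]0, T[) w (e, t) ^+ 2 <=
  (1 + (M - e)^-1) * (\int[leb2 R]_(z in orect e M T) w z ^+ 2
    + \int[leb2 R]_(z in orect e M T) wx z ^+ 2
    + \int[leb2 R]_(z in orect e M T) wt z ^+ 2).
Proof.
move=> Cw; have [cw cwx cwt _] := Cw; have [dx dt] := C1_rect_slices Cw.
pose c := (M - e)^-1.
have c0 : 0 < c by rewrite invr_gt0 subr_gt0.
pose U z := c * (z.1 - M) * (w z * w z).
pose Ux z := c * (w z * w z) + c * (z.1 - M) * (wx z * w z + w z * wx z).
have cU : rect_continuous e M T U by rewrite /U; rect_continuity.
have cUx : rect_continuous e M T Ux by rewrite /Ux; rect_continuity.
have dU : slice_dx e M T U Ux.
  by apply: slice_dxM; [exact: slice_dx_affine|exact: slice_dxM].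
have := divergence_x eM cU cUx dU.
have -> : \int[leb1 R]_(t in `]0, T[) (U (M, t) - U (e, t)) =
    \int[leb1 R]_(t in `]0, T[) w (e, t) ^+ 2.
  apply: eq_Rintegral => t _; rewrite /U /= /c; field.
  by rewrite subr_eq0 gt_eqF.
move=> <-.
have cw2 : rect_continuous e M T (fun z => w z ^+ 2) by rect_continuity.
have cwx2 : rect_continuous e M T (fun z => wx z ^+ 2) by rect_continuity.
have cwt2 : rect_continuous e M T (fun z => wt z ^+ 2) by rect_continuity.
have i1 := rect_continuous_integrable cw2; have i2 := rect_continuous_integrable cwx2.
have i3 := rect_continuous_integrable cwt2; have i4 := rect_continuous_integrable cUx.
rewrite -!RintegralD//; last exact: integrableRD.
rewrite -RintegralZl//; last by do 2! apply: integrableRD => //.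
apply: le_Rintegral => //.
  by apply: integrableRZ => //; do 2! apply: integrableRD => //.
move=> z [/= z1 _]; rewrite /Ux; move: z1; rewrite in_itv /= => /andP[z1 z1'].
set l := c * (z.1 - M).
have l1 : `|l| <= 1.
  rewrite normrM gtr0_norm// ltr0_norm ?subr_lt0// opprB /c mulrC.
  by rewrite ler_pdivrMr ?subr_gt0// mul1r; lra.
have lw : l * (2 * (w z * wx z)) <= w z ^+ 2 + wx z ^+ 2.
  apply: (le_trans (ler_norm _)); rewrite normrM.
  apply: (@le_trans _ _ `|2 * (w z * wx z)|); first exact: ler_piMl.
  by have := normM_le_half (w z) (wx z); rewrite (normrM 2) ger0_norm//; lra.
rewrite -/c.
have h1 := mulr_ge0 (ltW c0) (sqr_ge0 (wx z)).
have h2 := mulr_ge0 (ltW c0) (sqr_ge0 (wt z)).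
have h3 := sqr_ge0 (wt z); lra.
Qed.

(** As in edge_x_le, with the affine function of t of slope 1/T that vanishes at the
    end T - tau, opposite to tau; it is equal to 1 at T, or to -1 at 0. *)
Lemma edge_t_le (tau : R) w wx wt : tau = 0 \/ tau = T -> C1_rect e M T w wx wt ->
  \int[leb1 R]_(x in `]e, M[) w (x, tau) ^+ 2 <=
  (1 + T^-1) * (\int[leb2 R]_(z in orect e M T) w z ^+ 2
    + \int[leb2 R]_(z in orect e M T) wx z ^+ 2
    + \int[leb2 R]_(z in orect e M T) wt z ^+ 2).
Proof.
move=> tauE Cw; have [cw cwx cwt _] := Cw; have [dx dt] := C1_rect_slices Cw.
pose c := T^-1.
have c0 : 0 < c by rewrite invr_gt0.
pose a := T - tau.
pose U z := c * (z.2 - a) * (w z * w z).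
pose Ut z := c * (w z * w z) + c * (z.2 - a) * (wt z * w z + w z * wt z).
have cU : rect_continuous e M T U by rewrite /U; rect_continuity.
have cUt : rect_continuous e M T Ut by rewrite /Ut; rect_continuity.
have dU : slice_dt e M T U Ut.
  by apply: slice_dtM; [exact: slice_dt_affine|exact: slice_dtM].
have := divergence_t T0 cU cUt dU.
have -> : \int[leb1 R]_(x in `]e, M[) (U (x, T) - U (x, 0)) =
    \int[leb1 R]_(x in `]e, M[) w (x, tau) ^+ 2.
  apply: eq_Rintegral => x _; rewrite /U /= /c /a.
  by case: tauE => ->; field; rewrite gt_eqF.
move=> <-.
have cw2 : rect_continuous e M T (fun z => w z ^+ 2) by rect_continuity.
have cwx2 : rect_continuous e M T (fun z => wx z ^+ 2) by rect_continuity.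
have cwt2 : rect_continuous e M T (fun z => wt z ^+ 2) by rect_continuity.
have i1 := rect_continuous_integrable cw2; have i2 := rect_continuous_integrable cwx2.
have i3 := rect_continuous_integrable cwt2; have i4 := rect_continuous_integrable cUt.
rewrite -!RintegralD//; last exact: integrableRD.
rewrite -RintegralZl//; last by do 2! apply: integrableRD => //.
apply: le_Rintegral => //.
  by apply: integrableRZ => //; do 2! apply: integrableRD => //.
move=> z [/= _ z2]; rewrite /Ut; move: z2; rewrite in_itv /= => /andP[z2 z2'].
set l := c * (z.2 - a).
have l1 : `|l| <= 1.
  rewrite normrM gtr0_norm// /c mulrC ler_pdivrMr// mul1r ler_norml /a.
  by case: tauE => ->; apply/andP; split; lra.
have lw : l * (2 * (w z * wt z)) <= w z ^+ 2 + wt z ^+ 2.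
  apply: (le_trans (ler_norm _)); rewrite normrM.
  apply: (@le_trans _ _ `|2 * (w z * wt z)|); first exact: ler_piMl.
  by have := normM_le_half (w z) (wt z); rewrite (normrM 2) ger0_norm//; lra.
rewrite -/c.
have h1 := mulr_ge0 (ltW c0) (sqr_ge0 (wx z)).
have h2 := mulr_ge0 (ltW c0) (sqr_ge0 (wt z)).
have h3 := sqr_ge0 (wx z); lra.
Qed.

End TransportC1.

(** * Passage from C^1 functions to H^1 functions and their traces *)

Lemma ler_cvg_lin (R : realType) (a b c d : R) (x1 x2 x3 x4 x5 : nat -> R)
    (l1 l2 l3 l4 l5 : R) :
  x1 @ \oo --> l1 -> x2 @ \oo --> l2 -> x3 @ \oo --> l3 -> x4 @ \oo --> l4 ->
  x5 @ \oo --> l5 ->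
  (forall n, a * x1 n + b * x2 n <= x3 n + c * x4 n + d * x5 n) ->
  a * l1 + b * l2 <= l3 + c * l4 + d * l5.
Proof.
move=> h1 h2 h3 h4 h5 le.
apply: (@ler_cvg_to _ \oo _ _ (fun n => a * x1 n + b * x2 n)
  (fun n => x3 n + c * x4 n + d * x5 n)).
- by apply: cvgD; apply: cvgM => //; exact: cvg_cst.
- apply: cvgD; first apply: cvgD => //; by apply: cvgM => //; exact: cvg_cst.
- exact: nearW.
Qed.

Section TracesAsLimits.
Variables (R : realType) (e M T : R).
Hypotheses (eM : e < M) (T0 : 0 < T).
Implicit Types (u ux ut : R * R -> R) (un unx unt : nat -> R * R -> R).

Let mO : measurable (orect e M T : set (measurableTypeR R * measurableTypeR R)).
Proof. exact: measurable_orect. Qed.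
Let e_in : e \in `[e, M]. Proof. by rewrite in_itv /= lexx ltW. Qed.
Let O_in : 0 \in `[0, T]. Proof. by rewrite in_itv /= lexx ltW. Qed.
Let T_in : T \in `[0, T]. Proof. by rewrite in_itv /= lexx ltW. Qed.

Lemma rect_continuous_L2 u : rect_continuous e M T u -> L2 (leb2 R) (orect e M T) u.
Proof.
by move=> cu; apply: L2_bounded_mfun; [|exact: leb2_orect_lty|
  exact: rect_continuous_bounded_mfun].
Qed.

Definition H1conv un unx unt u ux ut : Prop :=
  [/\ forall n, C1_rect e M T (un n) (unx n) (unt n),
      L2conv (leb2 R) (orect e M T) un u,
      L2conv (leb2 R) (orect e M T) unx ux &
      L2conv (leb2 R) (orect e M T) unt ut].

(** The two properties of a side of the rectangle on which the theory of traces rests: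
    boundary values are square integrable, and controlled by the H^1 norm. *)
Definition edge_bounded (I : set R) (gamma : R -> R * R) : Prop :=
  measurable (I : set (measurableTypeR R)) /\
  (forall w, rect_continuous e M T w -> L2 (leb1 R) I (fun s => w (gamma s))) /\
  exists K : R, forall w wx wt, C1_rect e M T w wx wt ->
    \int[leb1 R]_(s in I) w (gamma s) ^+ 2 <=
    K * (\int[leb2 R]_(z in orect e M T) w z ^+ 2
      + \int[leb2 R]_(z in orect e M T) wx z ^+ 2
      + \int[leb2 R]_(z in orect e M T) wt z ^+ 2).

Lemma edge_bounded_x : edge_bounded `]0, T[ (fun t => (e, t)).
Proof.
split; first exact: measurable_itv.
split; last by exists (1 + (M - e)^-1) => w wx wt; exact: edge_x_le.
move=> w cw; apply: L2_bounded_mfun; [exact: measurable_itv|exact: leb1_oo_lty|].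
by apply: itv_bounded_mfun; exact: rect_continuous_slice_t e_in cw.
Qed.

Lemma edge_bounded_t tau : tau = 0 \/ tau = T ->
  edge_bounded `]e, M[ (fun x => (x, tau)).
Proof.
move=> tauE; split; first exact: measurable_itv.
split; last by exists (1 + T^-1) => w wx wt; exact: edge_t_le.
move=> w cw; apply: L2_bounded_mfun; [exact: measurable_itv|exact: leb1_oo_lty|].
have tau_in : tau \in `[0, T] by case: tauE => ->.
by apply: itv_bounded_mfun; exact: rect_continuous_slice_x tau_in cw.
Qed.

Lemma trace_H1conv I gamma u ux ut h : edge_bounded I gamma ->
  H1 (orect e M T) u ux ut -> is_trace e M T I gamma u ux ut h ->
  exists un unx unt, H1conv un unx unt u ux ut /\
    L2conv (leb1 R) I (fun n s => un n (gamma s)) h.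
Proof.
move=> [mI [eL2 _]] [Lu Lux Lut _] [Lh [un [unx [unt [Cn cu cux cut ch]]]]].
exists un, unx, unt.
have Ln n : L2 (leb2 R) (orect e M T) (un n) by apply: rect_continuous_L2; case: (Cn n).
have Lnx n : L2 (leb2 R) (orect e M T) (unx n) by apply: rect_continuous_L2; case: (Cn n).
have Lnt n : L2 (leb2 R) (orect e M T) (unt n) by apply: rect_continuous_L2; case: (Cn n).
have Lng n : L2 (leb1 R) I (fun s => un n (gamma s)) by apply: eL2; case: (Cn n).
split; first split => //.
- by split => //; apply/cvg_L2P.
- by split => //; apply/cvg_L2P.
- by split => //; apply/cvg_L2P.
- by split => //; apply/(cvg_L2P mI).
Qed.

(** The boundary values of every C^1 approximation of u tend to its trace: the difference
    of two C^1 approximations tends to 0 in H^1, hence its boundary values tend to 0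
    by the trace inequality. *)
Lemma H1conv_edge I gamma un unx unt u ux ut h : edge_bounded I gamma ->
  H1conv un unx unt u ux ut -> is_trace e M T I gamma u ux ut h ->
  H1 (orect e M T) u ux ut ->
  L2conv (leb1 R) I (fun n s => un n (gamma s)) h.
Proof.
move=> eb [Cu cu cux cut] tr Hu.
have [vn [vnx [vnt [[Cv cv cvx cvt] cvh]]]] := trace_H1conv eb Hu tr.
have [mI [eL2 [K hK]]] := eb.
have cB wn w w'n : L2conv (leb2 R) (orect e M T) wn w ->
    L2conv (leb2 R) (orect e M T) w'n w ->
    (fun n => \int[leb2 R]_(z in orect e M T) (wn n z - w'n n z) ^+ 2) @ \oo --> (0 : R).
  move=> c1 c2; have [_ _ c] := L2convD mO c1 (L2convN mO c2).
  rewrite [X in X @ _ --> _](_ : _ = fun n => \int[leb2 R]_(z in orect e M T)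
    (wn n z + - w'n n z - (w z + - w z)) ^+ 2) //.
  apply/funext => n; apply: eq_Rintegral => z _.
  by rewrite subrr subr0.
have L0 : L2 (leb1 R) I (fun s => 0).
  by apply: (eL2 (fun=> 0)); exact: rect_continuous_cst.
have c0 : L2conv (leb1 R) I (fun n s => un n (gamma s) - vn n (gamma s)) (fun=> 0).
  apply: (L2conv_bound (e := fun n => K *
    (\int[leb2 R]_(z in orect e M T) (un n z - vn n z) ^+ 2
     + \int[leb2 R]_(z in orect e M T) (unx n z - vnx n z) ^+ 2
     + \int[leb2 R]_(z in orect e M T) (unt n z - vnt n z) ^+ 2))) => //.
  - move=> n; apply: (L2B mI); apply: eL2; first by case: (Cu n).
    by case: (Cv n).
  - rewrite [X in _ --> X](_ : _ = K * (0 + 0 + 0)); last by rewrite !addr0 mulr0.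
    apply: cvgM; first exact: cvg_cst.
    apply: cvgD; first apply: cvgD; by [exact: cB cu cv|exact: cB cux cvx|exact: cB cut cvt].
  - move=> n; under eq_Rintegral do rewrite subr0.
    exact: hK (C1_rectB (Cu n) (Cv n)).
have := L2convD mI c0 cvh.
by under [X in L2conv _ _ X _ -> _]eq_fun do under eq_fun do rewrite subrK;
   under [X in L2conv _ _ _ X -> _]eq_fun do rewrite add0r.
Qed.

Lemma bounded_mfun_weight lambda alpha : bounded_mfun (orect e M T) (weight lambda alpha).
Proof. by apply: rect_continuous_bounded_mfun; exact: rect_continuous_weight. Qed.

Lemma bounded_mfun_weight_x lambda alpha a : a \in `[e, M] ->
  bounded_mfun `]0, T[ (fun t => weight lambda alpha (a, t)).
Proof.
move=> ain; apply: itv_bounded_mfun; apply: (rect_continuous_slice_t ain).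
exact: rect_continuous_weight.
Qed.

Lemma bounded_mfun_weight_t lambda alpha a : a \in `[0, T] ->
  bounded_mfun `]e, M[ (fun x => weight lambda alpha (x, a)).
Proof.
move=> ain; apply: itv_bounded_mfun; apply: (rect_continuous_slice_x ain).
exact: rect_continuous_weight.
Qed.

Lemma L2conv_sub_mul_fst (b : R -> R) un u vn v : {within `[e, M], continuous b} ->
  L2conv (leb2 R) (orect e M T) un u -> L2conv (leb2 R) (orect e M T) vn v ->
  L2conv (leb2 R) (orect e M T) (fun n z => un n z - b z.1 * vn n z)
    (fun z => u z - b z.1 * v z).
Proof.
move=> cb cu cv; have bb := rect_continuous_bounded_mfun (rect_continuous_fst (T := T) cb).
exact: (L2convD mO cu (L2convN mO (L2convM mO bb cv))).
Qed.

(** Every integral in transport_C1 is a weighted square, continuous in L^2 of the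
    rectangle or of a side; one C^1 approximation of u serves for the three sides. *)
Lemma transport_H1 (lambda alpha : R) (b : R -> R) (b0 b1 : R) u ux ut
    (u_e u_0 u_T : R -> R) :
  0 <= lambda -> 0 <= alpha -> alpha * b1 <= 2^-1 ->
  {within `[e, M], continuous b} ->
  (forall x, x \in `[e, M] -> b0 <= b x <= b1) ->
  H1 (orect e M T) u ux ut -> trace_x e M T e u ux ut u_e ->
  trace_t e M T 0 u ux ut u_0 -> trace_t e M T T u ux ut u_T ->
  lambda ^+ 2 / 4 * (\int[leb2 R]_(z in orect e M T)
     (weight lambda alpha z * u z ^+ 2))
  + lambda / 2 * b0 * (\int[leb1 R]_(x in `]e, M[)
     (weight lambda alpha (x, 0) * u_0 x ^+ 2)) <=
  \int[leb2 R]_(z in orect e M T)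
     (weight lambda alpha z * (ux z - b z.1 * ut z) ^+ 2)
  + lambda / 2 * (\int[leb1 R]_(t in `]0, T[)
     (weight lambda alpha (e, t) * u_e t ^+ 2))
  + lambda / 2 * b1 * (\int[leb1 R]_(x in `]e, M[)
     (weight lambda alpha (x, T) * u_T x ^+ 2)).
Proof.
move=> l0 a0 ab cb bb Hu tr_e tr_0 tr_T.
have [un [unx [unt [Hn cn_e]]]] := trace_H1conv edge_bounded_x Hu tr_e.
have cn_0 := H1conv_edge (edge_bounded_t (or_introl erefl)) Hn tr_0 Hu.
have cn_T := H1conv_edge (edge_bounded_t (or_intror erefl)) Hn tr_T Hu.
have [Cn cu cux cut] := Hn.
have bw := bounded_mfun_weight lambda alpha.
have bwe := bounded_mfun_weight_x lambda alpha e_in.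
have bw0 := bounded_mfun_weight_t lambda alpha O_in.
have bwT := bounded_mfun_weight_t lambda alpha T_in.
have m1 : measurable (`]e, M[%classic : set (measurableTypeR R))
  by exact: measurable_itv.
have m2 : measurable (`]0, T[%classic : set (measurableTypeR R))
  by exact: measurable_itv.
have q1 := L2conv_quad mO bw cu.
have q2 := L2conv_quad m1 bw0 cn_0.
have q3 := L2conv_quad mO bw (L2conv_sub_mul_fst cb cux cut).
have q4 := L2conv_quad m2 bwe cn_e.
have q5 := L2conv_quad m1 bwT cn_T.
apply: (ler_cvg_lin q1 q2 q3 q4 q5) => n.
have [cp cpx cpt _] := Cn n; have [dx dt] := C1_rect_slices (Cn n).
exact: transport_C1.
Qed.

(** The transport inequality along (1, 0) for q = p - m s, whose x-derivative is
    px - m sx - m' s.  The approximations of p and s may be unrelated, since q only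
    has to be C^1 before the limit. *)
Lemma conormal_H1 (lambda alpha : R) (m dm : R -> R) p px pt s sx st
    (p_e s_e : R -> R) :
  0 <= lambda -> 0 <= alpha -> C1_seg e M m dm ->
  H1 (orect e M T) p px pt -> trace_x e M T e p px pt p_e ->
  H1 (orect e M T) s sx st -> trace_x e M T e s sx st s_e ->
  lambda ^+ 2 / 4 * (\int[leb2 R]_(z in orect e M T)
     (weight lambda alpha z * (p z - m z.1 * s z) ^+ 2)) <=
  \int[leb2 R]_(z in orect e M T)
     (weight lambda alpha z * (px z - m z.1 * sx z - dm z.1 * s z) ^+ 2)
  + lambda / 2 * (\int[leb1 R]_(t in `]0, T[)
     (weight lambda alpha (e, t) * (p_e t - m e * s_e t) ^+ 2)).
Proof.
move=> l0 a0 [cm cdm dmE] Hp tr_p Hs tr_s.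
have [pn [pnx [pnt [[Cp cp cpx cpt] cp_e]]]] := trace_H1conv edge_bounded_x Hp tr_p.
have [sn [snx [snt [[Cs cs csx cst] cs_e]]]] := trace_H1conv edge_bounded_x Hs tr_s.
have bw := bounded_mfun_weight lambda alpha.
have bwe := bounded_mfun_weight_x lambda alpha e_in.
have m2 : measurable (`]0, T[%classic : set (measurableTypeR R))
  by exact: measurable_itv.
have q1 := L2conv_quad mO bw (L2conv_sub_mul_fst cm cp cs).
have q2 := L2conv_quad mO bw (L2conv_sub_mul_fst cdm (L2conv_sub_mul_fst cm cpx csx) cs).
have cc : L2conv (leb1 R) `]0, T[ (fun n t => pn n (e, t) - m e * sn n (e, t))
    (fun t => p_e t - m e * s_e t).
  apply: (L2convD m2) => //; apply: (L2convN m2); apply: (L2convM m2) => //.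
  exact: bounded_mfun_cst.
have q3 := L2conv_quad m2 bwe cc.
have q0 : (fun=> 0 : R) @ \oo --> (0 : R) by exact: cvg_cst.
have := ler_cvg_lin (a := lambda ^+ 2 / 4) (b := 0) (c := lambda / 2) (d := 0)
  q1 q0 q2 q3 q0.
rewrite !mul0r !addr0; apply => n; rewrite !addr0.
have [cp' cpx' cpt' _] := Cp n; have [pdx pdt] := C1_rect_slices (Cp n).
have [cs' csx' cst' _] := Cs n; have [sdx sdt] := C1_rect_slices (Cs n).
have cmz : rect_continuous e M T (fun z => m z.1) by exact: rect_continuous_fst.
have cdmz : rect_continuous e M T (fun z => dm z.1) by exact: rect_continuous_fst.
pose q z := pn n z - m z.1 * sn n z.
pose qx z := pnx n z - (dm z.1 * sn n z + m z.1 * snx n z).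
pose qt z := pnt n z - (0 * sn n z + m z.1 * snt n z).
have cq : rect_continuous e M T q by rewrite /q; rect_continuity.
have cqx : rect_continuous e M T qx by rewrite /qx; rect_continuity.
have cqt : rect_continuous e M T qt by rewrite /qt; rect_continuity.
have dq : slice_dx e M T q qx.
  by apply: slice_dxB => //; apply: slice_dxM => //; exact: slice_dx_fst.
have dqt : slice_dt e M T q qt.
  by apply: slice_dtB => //; apply: slice_dtM => //; exact: slice_dt_fst.
have cz : {within `[e, M], continuous (fun=> 0 : R)}.
  by apply: continuous_subspaceT => x; exact: cvg_cst.
have ab0 : alpha * 0 <= 2^-1 by rewrite mulr0 invr_ge0.
have bz (x : R) : x \in `[e, M] -> (0 : R) <= 0 <= (0 : R) by rewrite lexx.
(* b = 0, with bounds b0 = b1 = 0: the sides t = 0 and t = T disappear. *)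
have := transport_C1 eM T0 l0 a0 ab0 cz bz cq cqx cqt dq dqt.
rewrite !mulr0 !mul0r !addr0.
have E z : qx z - 0 * qt z = pnx n z - m z.1 * snx n z - dm z.1 * sn n z.
  by rewrite /qx; ring.
by under [X in _ <= X + _]eq_Rintegral do rewrite E.
Qed.

End TracesAsLimits.

(** * Integration by parts in t of the mixed term *)

Section ProductL2.
Context d1 d2 (T1 : measurableType d1) (T2 : measurableType d2) (R : realType).
Variables (m1 : {sigma_finite_measure set T1 -> \bar R})
          (m2 : {sigma_finite_measure set T2 -> \bar R}).
Variables (D1 : set T1) (D2 : set T2).
Hypotheses (mD1 : measurable D1) (mD2 : measurable D2).
Hypothesis D2oo : (m2 D2 < +oo)%E.

Lemma L2_comp_fst (h : T1 -> R) : L2 m1 D1 h ->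
  L2 (m1 \x m2)%E (D1 `*` D2) (fun z => h z.1).
Proof.
move=> [mh ih]; have mD : measurable (D1 `*` D2) by exact: measurableX.
have mhf : measurable_fun (D1 `*` D2) (fun z => h z.1).
  apply: (measurable_comp mD1) => //; first by move=> _ [z [/= z1 _] <-].
  by apply: measurable_funTS; exact: measurable_fst.
split => //; apply/(integrable_mkcond _ mD); apply/integrable12ltyP.
  apply/(measurable_restrictT _ mD).
  have mhf2 := measurable_funX 2 mhf.
  exact: ((measurable_EFinP _ _).2 mhf2).
have D2fin : m2 D2 \is a fin_num by rewrite ge0_fin_numE.
rewrite (eq_integral ((fun x => (fine (m2 D2) * h x ^+ 2)%:E) \_ D1)); last first.
  move=> x _; rewrite [RHS]patchE; case: ifPn => xe; last first.
    by rewrite integral0_eq// => y _; rewrite patchE in_setX (negbTE xe) /= normr0.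
  rewrite (eq_integral ((fun=> (h x ^+ 2)%:E) \_ D2)); last first.
    move=> y _; rewrite !patchE in_setX xe /=; case: ifPn => //=.
      by rewrite ger0_norm// sqr_ge0.
    by rewrite normr0.
  by rewrite -integral_mkcond integral_cst// (EFinM (fine _)) fineK// muleC.
rewrite -integral_mkcond.
by have := integrable_lty mD1 (integrableRZ mD1 (fine (m2 D2)) ih).
Qed.

End ProductL2.

Section MixedTerm.
Variables (R : realType) (e M T : R).
Hypotheses (eM : e < M) (T0 : 0 < T).

Let mO : measurable (orect e M T : set (measurableTypeR R * measurableTypeR R)).
Proof. exact: measurable_orect. Qed.
Let m1 : measurable (`]e, M[%classic : set (measurableTypeR R)).
Proof. exact: measurable_itv. Qed.
Let m2 : measurable (`]0, T[%classic : set (measurableTypeR R)).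
Proof. exact: measurable_itv. Qed.
Let O_in : 0 \in `[0, T]. Proof. by rewrite in_itv /= lexx ltW. Qed.
Let T_in : T \in `[0, T]. Proof. by rewrite in_itv /= lexx ltW. Qed.

Lemma leb1_0T : leb1 R `]0, T[%classic = T%:E.
Proof. by rewrite /leb1 lebesgue_measure_itv /= lte_fin T0 -EFinB subr0. Qed.

Lemma L2_fst (h : R -> R) : L2 (leb1 R) `]e, M[ h ->
  L2 (leb2 R) (orect e M T) (fun z => h z.1).
Proof. by move=> Lh; apply: (L2_comp_fst m1 m2 _ Lh); exact: leb1_oo_lty. Qed.

(** The weight decreases in t, so the left-hand side is at most T times its slice at
    t = 0. *)
Lemma Rintegral_weight_fst_le lambda alpha (h : R -> R) : 0 <= lambda -> 0 <= alpha ->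
  L2 (leb1 R) `]e, M[ h ->
  \int[leb2 R]_(z in orect e M T) (weight lambda alpha z * h z.1 ^+ 2) <=
  T * \int[leb1 R]_(x in `]e, M[) (weight lambda alpha (x, 0) * h x ^+ 2).
Proof.
move=> l0 a0 Lh; have Lhf := L2_fst Lh.
have bw0 : bounded_mfun (orect e M T) (fun z => weight lambda alpha (z.1, 0)).
  apply: rect_continuous_bounded_mfun.
  apply: (rect_continuous_fst (m := fun x => weight lambda alpha (x, 0))).
  by apply: (rect_continuous_slice_x O_in); exact: rect_continuous_weight.
have i0 := L2_integrable mO bw0 Lhf.
have bwx := bounded_mfun_weight_t e M lambda alpha O_in.
have i1 := L2_integrable m1 bwx Lh.
apply: (@le_trans _ _ (\int[leb2 R]_(z in orect e M T)
    (weight lambda alpha (z.1, 0) * h z.1 ^+ 2))).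
  apply: le_Rintegral => //.
  - by apply: (L2_integrable mO) => //; exact: bounded_mfun_weight.
  - move=> [x t] [/= _ t0]; apply: ler_wpM2r; first exact: sqr_ge0.
    rewrite /weight ler_expR /= lerN2 mulr0 addr0 ler_wpM2l ?mulr_ge0//.
    by rewrite lerDl mulr_ge0//; move: t0; rewrite in_itv /= => /andP[/ltW].
rewrite -RintegralZl//.
rewrite /orect (Rintegral_setX12
  (H := fun x => T * (weight lambda alpha (x, 0) * h x ^+ 2)) m1 m2 i0)//.
move=> x _ /=; set c := _ * _.
transitivity (c%:E * leb1 R `]0%R, T[%classic)%E; last by rewrite leb1_0T -EFinM mulrC.
exact: (integral_cst (leb1 R) m2).
Qed.

(** A bound for the part of the mixed integral that can be negative, when G bounds g
    and its t-derivative.  The integral over t = T is of a kind that the estimate allows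
    on its right-hand side with a minus sign; the others are controlled by
    carleman_core, with a higher power of lambda. *)
Definition mixed_defect lambda alpha G (p : R * R -> R) (p_0 p_T h : R -> R) : R :=
  G / 2 * (\int[leb1 R]_(x in `]e, M[) (weight lambda alpha (x, T) * p_T x ^+ 2))
  + G / 2 * (\int[leb1 R]_(x in `]e, M[) (weight lambda alpha (x, 0) * p_0 x ^+ 2))
  + (G + (G + 2 * lambda * alpha * G) / 2 * T) *
     (\int[leb1 R]_(x in `]e, M[) (weight lambda alpha (x, 0) * h x ^+ 2))
  + (G + 2 * lambda * alpha * G) / 2 *
     (\int[leb2 R]_(z in orect e M T) (weight lambda alpha z * p z ^+ 2)).

(** Integration by parts in t moves the derivative from p to phi g, as h depends on x
    alone; each of the three products p h that result is split by
    |p h| <= (p^2 + h^2) / 2, and the weight of h^2 is compared with its value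
    at t = 0. *)
Lemma mixed_C1 lambda alpha (G : R) (g gt : R * R -> R) p px pt (h : R -> R) :
  0 <= lambda -> 0 <= alpha ->
  rect_continuous e M T g -> rect_continuous e M T gt -> slice_dt e M T g gt ->
  (forall z, crect e M T z -> `|g z| <= G) ->
  (forall z, crect e M T z -> `|gt z| <= G) ->
  C1_rect e M T p px pt -> L2 (leb1 R) `]e, M[ h ->
  - mixed_defect lambda alpha G p (fun x => p (x, 0)) (fun x => p (x, T)) h <=
  \int[leb2 R]_(z in orect e M T) (weight lambda alpha z * g z * (pt z * h z.1)).
Proof.
move=> l0 a0 cg cgt dg hg hgt Cp Lh; have Lhf := L2_fst Lh.
have [cp _ cpt _] := Cp; have [_ dp] := C1_rect_slices Cp.
set phi := weight lambda alpha.
have cphi : rect_continuous e M T phi by exact: rect_continuous_weight.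
pose U z := phi z * (g z * p z).
pose Ut z := - (2 * lambda * alpha) * phi z * (g z * p z)
  + phi z * (gt z * p z + g z * pt z).
have cU : rect_continuous e M T U by rewrite /U; rect_continuity.
have cUt : rect_continuous e M T Ut by rewrite /Ut; rect_continuity.
have dU : slice_dt e M T U Ut.
  by apply: slice_dtM; [exact: slice_dt_weight|exact: slice_dtM].
have G0 : 0 <= G.
  apply: le_trans (hg (e, 0) _); first exact: normr_ge0.
  by split; rewrite /= in_itv /= lexx ltW.
have b1 : bounded_mfun (orect e M T) (fun=> 1 : R) by exact: bounded_mfun_cst.
have L (u : R * R -> R) : rect_continuous e M T u -> L2 (leb2 R) (orect e M T) u.
  exact: rect_continuous_L2.
have bphi : bounded_mfun (orect e M T) phi by exact: rect_continuous_bounded_mfun.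
have bphi0 := bounded_mfun_weight_t e M lambda alpha O_in.
have bphiT := bounded_mfun_weight_t e M lambda alpha T_in.
have Lp a : a \in `[0, T] -> L2 (leb1 R) `]e, M[ (fun x => p (x, a)).
  move=> ain; apply: L2_bounded_mfun; [exact: m1|exact: leb1_oo_lty|].
  by apply: itv_bounded_mfun; exact: rect_continuous_slice_x ain cp.
have iUt : (leb2 R).-integrable (orect e M T) (EFin \o (fun z => Ut z * h z.1)).
  have := L2_mul_integrable mO b1 (L _ cUt) Lhf.
  by under [X in _.-integrable _ (_ \o X) -> _]eq_fun do rewrite mul1r.
have iUa a : a \in `[0, T] ->
    (leb1 R).-integrable `]e, M[ (EFin \o (fun x => U (x, a) * h x)).
  move=> ain; have bUa : bounded_mfun `]e, M[%classic (fun x => U (x, a)).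
    by apply: itv_bounded_mfun; exact: rect_continuous_slice_x ain cU.
  have := L2_mul_integrable m1 bUa
    (L2_bounded_mfun m1 (leb1_oo_lty _ _) (bounded_mfun_cst _ 1)) Lh.
  by under [X in _.-integrable _ (_ \o X) -> _]eq_fun do rewrite mul1r.
have IBP : \int[leb2 R]_(z in orect e M T) (Ut z * h z.1) =
    \int[leb1 R]_(x in `]e, M[) (U (x, T) * h x - U (x, 0) * h x).
  apply: (Rintegral_setX12 m1 m2 iUt) => x /= xeM.
  have xeM' := subset_itv_oo_cc xeM.
  apply: (FTC_oo (F := fun t => U (x, t) * h x) T0).
  - by move=> t; apply: cvgM; [exact: (rect_continuous_slice_t xeM' cUt)|exact: cvg_cst].
  - by move=> t; apply: cvgM; [exact: (rect_continuous_slice_t xeM' cU)|exact: cvg_cst].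
  - move=> t t0; have dd : is_derive t (1 : R) (fun t => U (x, t)) (Ut (x, t)).
      exact: (dU (x, t)).
    apply: (is_derive_eq (is_deriveM dd (is_derive_cst (h x) t 1))).
    by rewrite /GRing.scale /=; ring.
(* 2 c bounds |g_t - 2 lambda alpha g|, where phi (g_t - 2 lambda alpha g) is the
   t-derivative of phi g. *)
pose c := (G + 2 * lambda * alpha * G) / 2.
have c0 : 0 <= c by rewrite divr_ge0// addr_ge0// !mulr_ge0.
have wab (w k a b : R) : 0 <= w -> `|k| <= G ->
    - (G / 2 * (w * a ^+ 2) + G / 2 * (w * b ^+ 2)) <= w * (k * a) * b.
  move=> w0 kG; rewrite [X in _ <= X](_ : _ = w * (k * (a * b))); last by ring.
  rewrite [X in X <= _](_ : _ = w * - (G * ((a ^+ 2 + b ^+ 2) / 2))); last by ring.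
  apply: ler_wpM2l => //; rewrite lerNl; apply: le_trans (ler_norm _) _.
  rewrite normrN normrM; apply: ler_pM => //.
  exact: normM_le_half.
have bndT : - (G / 2 * (\int[leb1 R]_(x in `]e, M[) (phi (x, T) * p (x, T) ^+ 2))
      + G / 2 * (\int[leb1 R]_(x in `]e, M[) (phi (x, 0) * h x ^+ 2))) <=
    \int[leb1 R]_(x in `]e, M[) (U (x, T) * h x).
  have i1 := L2_integrable m1 bphiT (Lp _ T_in).
  have i2 := L2_integrable m1 bphi0 Lh.
  rewrite -!RintegralZl// -RintegralD//; [|exact: integrableRZ..].
  have i3 := integrableRD m1 (integrableRZ m1 (G / 2) i1) (integrableRZ m1 (G / 2) i2).
  rewrite -mulN1r -RintegralZl//; apply: le_Rintegral => //.
  - exact: integrableRZ.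
  - exact: iUa.
  - move=> x /= xeM; rewrite mulN1r.
    apply: le_trans (wab (phi (x, T)) (g (x, T)) (p (x, T)) (h x) (weight_ge0 _ _ _) _).
      rewrite lerN2 lerD2l; apply: ler_wpM2l; first exact: divr_ge0.
      apply: ler_wpM2r; first exact: sqr_ge0.
      rewrite /phi /weight ler_expR /= lerN2 mulr0 addr0 ler_wpM2l ?mulr_ge0//.
      by rewrite lerDl mulr_ge0// ltW.
    by apply: hg; split => //; exact: subset_itv_oo_cc.
have bnd0 : \int[leb1 R]_(x in `]e, M[) (U (x, 0) * h x) <=
    G / 2 * (\int[leb1 R]_(x in `]e, M[) (phi (x, 0) * p (x, 0) ^+ 2))
      + G / 2 * (\int[leb1 R]_(x in `]e, M[) (phi (x, 0) * h x ^+ 2)).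
  have i1 := L2_integrable m1 bphi0 (Lp _ O_in).
  have i2 := L2_integrable m1 bphi0 Lh.
  rewrite -!RintegralZl// -RintegralD//; [|exact: integrableRZ..].
  have i3 := integrableRD m1 (integrableRZ m1 (G / 2) i1) (integrableRZ m1 (G / 2) i2).
  apply: le_Rintegral => //; first exact: iUa.
  move=> x /= xeM.
  have := wab (phi (x, 0)) (- g (x, 0)) (p (x, 0)) (h x) (weight_ge0 _ _ _).
  rewrite normrN => /(_ (hg _ _)) wab'.
  rewrite -lerN2 (_ : - (U (x, 0) * h x) = phi (x, 0) * (- g (x, 0) * p (x, 0)) * h x).
    by apply: wab'; split => //; exact: subset_itv_oo_cc.
  by rewrite /U; ring.
have bndD : \int[leb2 R]_(z in orect e M T) (Ut z * h z.1) <=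
   \int[leb2 R]_(z in orect e M T) (phi z * g z * (pt z * h z.1))
   + (c * (\int[leb2 R]_(z in orect e M T) (phi z * p z ^+ 2))
     + c * (\int[leb2 R]_(z in orect e M T) (phi z * h z.1 ^+ 2))).
  have i1 := L2_integrable mO bphi (L _ cp).
  have i2 := L2_integrable mO bphi Lhf.
  have i3 := L2_mul_integrable mO
    (bounded_mfunM bphi (rect_continuous_bounded_mfun cg)) (L _ cpt) Lhf.
  have i4 := integrableRD mO (integrableRZ mO c i1) (integrableRZ mO c i2).
  rewrite -!RintegralZl// -RintegralD//; [|exact: integrableRZ..].
  rewrite -RintegralD//; apply: le_Rintegral => //; first exact: integrableRD.
  move=> z /orect_sub zD; rewrite /Ut.
  have w0 : 0 <= phi z by exact: weight_ge0.
  have hk : `|gt z - 2 * lambda * alpha * g z| <= 2 * c.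
    have -> : 2 * c = G + 2 * lambda * alpha * G by rewrite /c; field.
    apply: (le_trans (ler_normB _ _)); apply: lerD; first exact: hgt.
    by rewrite normrM ger0_norm ?mulr_ge0//; apply: ler_wpM2l; [rewrite !mulr_ge0|exact: hg].
  rewrite [X in X <= _](_ : _ = phi z * g z * (pt z * h z.1)
     + phi z * ((gt z - 2 * lambda * alpha * g z) * (p z * h z.1))); last by ring.
  rewrite lerD2l -mulrDr.
  rewrite [X in _ <= X](_ : _ = phi z * (2 * c * ((p z ^+ 2 + h z.1 ^+ 2) / 2)));
    last by field.
  apply: ler_wpM2l => //; apply: (le_trans (ler_norm _)).
  rewrite normrM; apply: ler_pM => //.
  exact: normM_le_half.
have bndh := Rintegral_weight_fst_le l0 a0 Lh.
have iUT := iUa _ T_in; have iU0 := iUa _ O_in.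
rewrite RintegralB// in IBP.
have {}bndh := ler_wpM2l c0 bndh.
rewrite /mixed_defect -/phi -/c; rewrite -/phi in bndh.
move: bndT bnd0 bndD bndh; rewrite IBP.
do ![set I := Rintegral _ _ _; move: I => ?]; clear; lra.
Qed.

Lemma mixed_H1 lambda alpha (G : R) (g gt : R * R -> R) p px pt
    (p_0 p_T h : R -> R) :
  0 <= lambda -> 0 <= alpha ->
  rect_continuous e M T g -> rect_continuous e M T gt -> slice_dt e M T g gt ->
  (forall z, crect e M T z -> `|g z| <= G) ->
  (forall z, crect e M T z -> `|gt z| <= G) ->
  H1 (orect e M T) p px pt -> trace_t e M T 0 p px pt p_0 ->
  trace_t e M T T p px pt p_T -> L2 (leb1 R) `]e, M[ h ->
  - mixed_defect lambda alpha G p p_0 p_T h <=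
  \int[leb2 R]_(z in orect e M T) (weight lambda alpha z * g z * (pt z * h z.1)).
Proof.
move=> l0 a0 cg cgt dg hg hgt Hp tr_0 tr_T Lh.
have eb0 := edge_bounded_t e M T0 (or_introl erefl : (0 : R) = 0 \/ 0 = T).
have ebT := edge_bounded_t e M T0 (or_intror erefl : T = 0 \/ T = T).
have [pn [pnx [pnt [Hn cn_0]]]] := trace_H1conv eb0 Hp tr_0.
have cn_T := H1conv_edge ebT Hn tr_T Hp.
have [Cn cp cpx cpt] := Hn.
have bw : bounded_mfun (orect e M T) (weight lambda alpha) by exact: bounded_mfun_weight.
have q1 := L2conv_quad m1 (bounded_mfun_weight_t e M lambda alpha T_in) cn_T.
have q2 := L2conv_quad m1 (bounded_mfun_weight_t e M lambda alpha O_in) cn_0.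
have q3 := L2conv_quad mO bw cp.
have q4 := L2conv_bilin mO
  (bounded_mfunM bw (rect_continuous_bounded_mfun cg)) cpt (L2_fst Lh).
apply: (@ler_cvg_to _ \oo _ _ (fun n => - mixed_defect lambda alpha G (pn n)
    (fun x => pn n (x, 0)) (fun x => pn n (x, T)) h) _ _ _ _ q4).
- apply: cvgN; apply: cvgD; last by apply: cvgM => //; exact: cvg_cst.
  apply: cvgD; last by apply: cvgM; exact: cvg_cst.
  by apply: cvgD; apply: cvgM => //; exact: cvg_cst.
- by apply: nearW => n; apply: mixed_C1 cg cgt dg hg hgt (Cn n) Lh.
Qed.

End MixedTerm.

(** * Combination of the three weighted estimates *)

Lemma le_max_norm (R : realType) (U : topologicalType) (D : set U) (f : U -> R) z :
  compact D -> {within D, continuous f} -> D z -> `|f z| <= max_norm D f.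
Proof.
move=> cD cf Dz; have [K hK] := compact_continuous_bounded cD cf.
apply: ub_le_sup; last by exists z.
by exists K => _ [y Dy <-]; exact: hK.
Qed.

Lemma max_norm_ge0 (R : realType) (U : topologicalType) (D : set U) (f : U -> R) z :
  compact D -> {within D, continuous f} -> D z -> 0 <= max_norm D f.
Proof. by move=> cD cf Dz; exact: le_trans (le_max_norm cD cf Dz). Qed.

(** P, S, Q, V, F stand for the weighted integrals of v_x^2, v_t^2, q^2, v^2 and
    (L_0 v)^2, and E, Z, W for those over the sides x = e, t = 0 and t = T.  The term
    m2^2 S is absorbed by the left-hand side: it is at most
    lambda^2 m0^2 S / 64 <= lambda^2 (P + Q) / 32. *)
Lemma combine_estimates (R : realFieldType) (lambda m0 m1 m2 F P S V Q Ep Es Ev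
    Zp Zv Wp Wv : R) :
  0 <= lambda -> 0 < m0 -> m0 < m1 -> 0 <= m2 -> 8 * m2 <= lambda * m0 ->
  0 <= F -> 0 <= S -> 0 <= Ep -> 0 <= Es -> 0 <= Zp -> 0 <= Wp ->
  lambda ^+ 2 / 4 * P + lambda / 2 * m0 * Zp <=
    F + lambda / 2 * Ep + lambda / 2 * m1 * Wp ->
  lambda ^+ 2 / 4 * Q <= 2 * F + 2 * m2 ^+ 2 * S + lambda * (Ep + m1 ^+ 2 * Es) ->
  lambda ^+ 2 / 4 * V + lambda / 2 * m0 * Zv <=
    Q + lambda / 2 * Ev + lambda / 2 * m1 * Wv ->
  m0 ^+ 2 * S <= 2 * P + 2 * Q ->
  3 / 16 * (lambda ^+ 2 * P) + m0 ^+ 2 / 32 * (lambda ^+ 2 * S)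
  + lambda ^+ 4 / 64 * V
  + m0 / 2 * (lambda * Zp) + m0 / 32 * (lambda ^+ 3 * Zv) <=
  4 * F + lambda * (2 * Ep + m1 ^+ 2 * Es) + lambda ^+ 3 / 32 * Ev
  + m1 * (lambda * Wp) + m1 / 32 * (lambda ^+ 3 * Wv).
Proof.
move=> l0 m0_gt0 m01 m2_ge0 lm2 F0 S0 Ep0 Es0 Zp0 Wp0 A B C D.
have m22 : m2 ^+ 2 <= lambda ^+ 2 * m0 ^+ 2 / 64.
  have : (8 * m2) ^+ 2 <= (lambda * m0) ^+ 2.
    by rewrite lerXn2r ?nnegrE ?mulr_ge0// ltW.
  by rewrite !exprMn; lra.
have {}m22 := ler_wpM2r S0 m22.
have {}D := ler_wpM2l (sqr_ge0 lambda) D.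
have {}C := ler_wpM2l (sqr_ge0 lambda) C.
have {}Ep0 := mulr_ge0 l0 Ep0.
have {}Es0 := mulr_ge0 l0 (mulr_ge0 (sqr_ge0 m1) Es0).
have {}Wp0 := mulr_ge0 (mulr_ge0 l0 (ltW (lt_trans m0_gt0 m01))) Wp0.
have {}Zp0 := mulr_ge0 (mulr_ge0 l0 (ltW m0_gt0)) Zp0.
lra.
Qed.

(** The coefficients gained on v_x^2 and on v(x,0)^2, of orders lambda^2 and lambda^3,
    exceed those of the defect, of order lambda, so a part of the gain remains; on the
    side t = 0 the gain on v_x^2, of order lambda, exceeds G.  The side t = T of the
    defect is charged to the constant m1 + G. *)
Lemma absorb_mixed (R : realFieldType) (lambda T c m0 m1 G k Gam F J P S V Ep Es Ev
    Zp Zv Wp Wv : R) :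
  1 <= lambda -> 0 <= T -> 0 < m0 -> 0 < m1 -> 0 <= G -> 0 <= k ->
  c <= 1 / 16 / 16 -> c <= m0 ^+ 2 / 16 / 16 ->
  32 * k <= lambda -> 16 * (16 * G + 8 * k * T) <= lambda * m0 ->
  Gam <= lambda * k / 2 ->
  0 <= P -> 0 <= S -> 0 <= V -> 0 <= Ep -> 0 <= Es -> 0 <= Ev ->
  0 <= Zp -> 0 <= Zv -> 0 <= Wp -> 0 <= Wv ->
  - (G / 2 * Wp + G / 2 * Zp + (G + Gam * T) * Zv + Gam * P) <= J ->
  3 / 16 * (lambda ^+ 2 * P) + m0 ^+ 2 / 32 * (lambda ^+ 2 * S)
  + lambda ^+ 4 / 64 * V
  + m0 / 2 * (lambda * Zp) + m0 / 32 * (lambda ^+ 3 * Zv) <=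
  4 * F + lambda * (2 * Ep + m1 ^+ 2 * Es) + lambda ^+ 3 / 32 * Ev
  + m1 * (lambda * Wp) + m1 / 32 * (lambda ^+ 3 * Wv) ->
  c * lambda * (P + S + lambda ^+ 2 * V)
  - (1 + m1 ^+ 2) * lambda * (Ep + lambda ^+ 2 * Ev + Es)
  + m0 / 16 / 16 * lambda * (Zp + lambda ^+ 2 * Zv)
  - (m1 + G) * lambda * (Wp + lambda ^+ 2 * Wv) <= F + J.
Proof.
move=> l1 T0 m0_gt0 m1_gt0 G0 k0 c1 c2 kl GTl Gaml P0 S0 V0 Ep0 Es0 Ev0
  Zp0 Zv0 Wp0 Wv0 mixed core.
have l0 : 0 <= lambda by exact: le_trans l1.
have l2 : lambda <= lambda ^+ 2 by rewrite expr2 ler_peMr.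
have l20 : 0 <= lambda ^+ 2 by exact: sqr_ge0.
have l30 : 0 <= lambda ^+ 3 by exact: exprn_ge0.
have l4 : lambda ^+ 3 <= lambda ^+ 4 by rewrite exprS ler_peMl.
have hP : 4 * c * (lambda * P) <= 3 / 16 * (lambda ^+ 2 * P) - 4 * (Gam * P).
  rewrite !mulrA -mulrBl; apply: ler_wpM2r => //.
  have := ler_wpM2l l0 kl; have := ler_wpM2r l0 c1; rewrite -expr2; lra.
have hS : 4 * c * (lambda * S) <= m0 ^+ 2 / 32 * (lambda ^+ 2 * S).
  rewrite !mulrA; apply: ler_wpM2r => //.
  have := ler_wpM2r l0 c2; have := ler_wpM2l (sqr_ge0 m0) l2.
  by have := mulr_ge0 (sqr_ge0 m0) l0; lra.
have hV : 4 * c * (lambda ^+ 3 * V) <= lambda ^+ 4 / 64 * V.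
  rewrite !mulrA; apply: ler_wpM2r => //.
  by have := ler_wpM2r l30 c1; lra.
have kT : 0 <= k * T by exact: mulr_ge0.
have hZp : m0 / 64 * (lambda * Zp) <= m0 / 2 * (lambda * Zp) - 2 * (G * Zp).
  rewrite !mulrA -mulrBl; apply: ler_wpM2r => //; lra.
have hZv : m0 / 64 * (lambda ^+ 3 * Zv) <=
    m0 / 32 * (lambda ^+ 3 * Zv) - 4 * ((G + Gam * T) * Zv).
  rewrite !mulrA -mulrBl; apply: ler_wpM2r => //.
  have h1 := ler_wpM2r T0 Gaml.
  have h2 := ler_wpM2l l0 GTl.
  have h3 : G <= lambda * G by rewrite ler_peMl.
  have h4 : m0 * lambda ^+ 2 <= m0 * lambda ^+ 3.
    by rewrite ler_pM2l// [leRHS]exprS ler_peMl.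
  by move: h2; rewrite (mulrA lambda lambda) -expr2; lra.
have hEp := mulr_ge0 (mulr_ge0 (sqr_ge0 m1) l0) Ep0.
have hEs := mulr_ge0 (mulr_ge0 (sqr_ge0 m1) l0) Es0.
have hEv := mulr_ge0 (mulr_ge0 (sqr_ge0 m1) l30) Ev0.
have hE1 := mulr_ge0 l0 Ep0; have hE2 := mulr_ge0 l0 Es0.
have hE3 := mulr_ge0 l30 Ev0.
have hW1 := mulr_ge0 (ltW m1_gt0) (mulr_ge0 l0 Wp0).
have hW2 := mulr_ge0 (ltW m1_gt0) (mulr_ge0 l30 Wv0).
have hW3 : G * Wp <= G * (lambda * Wp) by apply: ler_wpM2l => //; exact: ler_peMl.
have hW4 := mulr_ge0 G0 (mulr_ge0 l30 Wv0).
have hW5 := mulr_ge0 G0 (mulr_ge0 l0 Wp0).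
lra.
Qed.

Section Combination.
Variables (R : realType) (e M T m0 m1 m2 lambda alpha : R) (m : R -> R).
Variables (v vx vt vxx vxt vtt : R * R -> R).
Variables (v_e vx_e vt_e v_0 vx_0 v_T vx_T : R -> R).
Hypotheses (eM : e < M) (T0 : 0 < T) (cm : coefficient e M m0 m1 m2 m).
Hypotheses (a0 : 0 <= alpha) (am1 : alpha * m1 <= 2^-1).
Hypotheses (l1 : 1 <= lambda) (lm2 : 8 * m2 <= lambda * m0).
Hypothesis Hv : H2 (orect e M T) v vx vt vxx vxt vtt.
Hypothesis tr : traces e M T v vx vt vxx vxt vtt v_e vx_e vt_e v_0 vx_0 v_T vx_T.

Let mO : measurable (orect e M T : set (measurableTypeR R * measurableTypeR R)).
Proof. exact: measurable_orect. Qed.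
Let mX : measurable (`]e, M[%classic : set (measurableTypeR R)).
Proof. exact: measurable_itv. Qed.
Let mT : measurable (`]0, T[%classic : set (measurableTypeR R)).
Proof. exact: measurable_itv. Qed.
Let e_in : e \in `[e, M]. Proof. by rewrite in_itv /= lexx ltW. Qed.
Let O_in : 0 \in `[0, T]. Proof. by rewrite in_itv /= lexx ltW. Qed.
Let T_in : T \in `[0, T]. Proof. by rewrite in_itv /= lexx ltW. Qed.

Notation phi := (weight lambda alpha).

Definition inside (u : R * R -> R) : R :=
  \int[leb2 R]_(z in orect e M T) (phi z * u z ^+ 2).
Definition edge_e (h : R -> R) : R :=
  \int[leb1 R]_(t in `]0, T[) (phi (e, t) * h t ^+ 2).
Definition edge_t (tau : R) (h : R -> R) : R :=
  \int[leb1 R]_(x in `]e, M[) (phi (x, tau) * h x ^+ 2).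

Let weighted_ge0 d (A : measurableType d) (mu : {measure set A -> \bar R})
    (D : set A) (w h : A -> R) : (forall z, 0 <= w z) ->
  0 <= \int[mu]_(z in D) (w z * h z ^+ 2).
Proof.
by move=> w0; apply: Rintegral_ge0 => z _; rewrite mulr_ge0 ?sqr_ge0.
Qed.

Lemma inside_ge0 u : 0 <= inside u.
Proof. by apply: weighted_ge0 => z; exact: weight_ge0. Qed.
Lemma edge_e_ge0 h : 0 <= edge_e h.
Proof. by apply: weighted_ge0 => z; exact: weight_ge0. Qed.
Lemma edge_t_ge0 tau h : 0 <= edge_t tau h.
Proof. by apply: weighted_ge0 => z; exact: weight_ge0. Qed.

Let Lv : L2 (leb2 R) (orect e M T) v. Proof. by case: Hv => -[]. Qed.
Let Lvx : L2 (leb2 R) (orect e M T) vx. Proof. by case: Hv => -[]. Qed.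
Let Lvt : L2 (leb2 R) (orect e M T) vt. Proof. by case: Hv => -[]. Qed.
Let bphi : bounded_mfun (orect e M T) phi. Proof. exact: bounded_mfun_weight. Qed.
Let bphie := bounded_mfun_weight_x T lambda alpha e_in.
Let bphi0 := bounded_mfun_weight_t e M lambda alpha O_in.
Let bphiT := bounded_mfun_weight_t e M lambda alpha T_in.

Lemma carleman_rhsE C1 C2 C3 C4 :
  carleman_rhs e M T lambda alpha C1 C2 C3 C4 v vx vt v_e vx_e vt_e v_0 vx_0 v_T vx_T =
  C1 * lambda * (inside vx + inside vt + lambda ^+ 2 * inside v)
  - C2 * lambda * (edge_e vx_e + lambda ^+ 2 * edge_e v_e + edge_e vt_e)
  + C3 * lambda * (edge_t 0 vx_0 + lambda ^+ 2 * edge_t 0 v_0)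
  - C4 * lambda * (edge_t T vx_T + lambda ^+ 2 * edge_t T v_T).
Proof.
have [[Lve _] [Lvxe _] [Lvte _] [Lv0 _] [Lvx0 _] [LvT _] [LvxT _]] := tr.
have i1 := L2_integrable mO bphi Lvx; have i2 := L2_integrable mO bphi Lvt.
have i3 := L2_integrable mO bphi Lv.
have j1 := L2_integrable mT bphie Lvxe; have j2 := L2_integrable mT bphie Lve.
have j3 := L2_integrable mT bphie Lvte.
have k1 := L2_integrable mX bphi0 Lvx0; have k2 := L2_integrable mX bphi0 Lv0.
have n1 := L2_integrable mX bphiT LvxT; have n2 := L2_integrable mX bphiT LvT.
rewrite /carleman_rhs /inside /edge_e /edge_t; congr (_ * _ - _ * _ + _ * _ - _ * _).
- rewrite -RintegralZl// -RintegralD// -?RintegralD//;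
    [|exact: integrableRD|exact: integrableRZ].
  by apply: eq_Rintegral => z _; ring.
- rewrite -RintegralZl// -RintegralD//; last exact: integrableRZ.
  rewrite -RintegralD//; last by apply: integrableRD => //; exact: integrableRZ.
  by apply: eq_Rintegral => z _; ring.
- rewrite -RintegralZl// -RintegralD//; last exact: integrableRZ.
  by apply: eq_Rintegral => z _; ring.
- rewrite -RintegralZl// -RintegralD//; last exact: integrableRZ.
  by apply: eq_Rintegral => z _; ring.
Qed.

(** m v_t = v_x - q, and m is at least m0. *)
Lemma inside_conormal_ge : m0 ^+ 2 * inside vt <=
  2 * inside vx + 2 * inside (fun z => vx z - m z.1 * vt z).
Proof.
have [m0_gt0 m01 hm [dm [[cmm _ _] _]]] := cm.
have Lq : L2 (leb2 R) (orect e M T) (fun z => vx z - m z.1 * vt z).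
  apply: (L2B mO) => //; apply: (L2M mO) => //; apply: rect_continuous_bounded_mfun.
  exact: rect_continuous_fst.
have i1 := L2_integrable mO bphi Lvx; have i2 := L2_integrable mO bphi Lvt.
have i3 := L2_integrable mO bphi Lq.
rewrite /inside -!RintegralZl// -RintegralD//; try exact: integrableRZ.
apply: le_Rintegral => //; first exact: integrableRZ.
  by apply: integrableRD => //; exact: integrableRZ.
move=> z [/= z1 _]; have /andP[h0 _] := hm _ (subset_itv_oo_cc z1).
rewrite !(mulrCA _ (phi z)) -mulrDr; apply: ler_wpM2l; first exact: weight_ge0.
apply: (@le_trans _ _ (m z.1 ^+ 2 * vt z ^+ 2)).
  apply: ler_wpM2r; first exact: sqr_ge0.
  by rewrite lerXn2r ?nnegrE ?ltW//; exact: lt_trans h0.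
by have := sqr_ge0 (vx z + (vx z - m z.1 * vt z)); lra.
Qed.

(** Since q_x = L_0 v - m' v_t, the source of q costs, besides L_0 v, a term in v_t
    with a coefficient independent of lambda. *)
Lemma conormal_estimate :
  lambda ^+ 2 / 4 * inside (fun z => vx z - m z.1 * vt z) <=
  2 * inside (L0 m vxx vxt) + 2 * m2 ^+ 2 * inside vt
  + lambda * (edge_e vx_e + m1 ^+ 2 * edge_e vt_e).
Proof.
have [m0_gt0 m01 hm [dm [dmE m2E]]] := cm; have [cmm cdm _] := dmE.
have [_ Hvx Hvt] := Hv; have [_ tvxe tvte _ _ _ _] := tr.
have l0 : 0 <= lambda by exact: le_trans l1.
have := conormal_H1 eM T0 l0 a0 dmE Hvx tvxe Hvt tvte.
have [_ Lvxx Lvxt _] := Hvx.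
have bm := rect_continuous_bounded_mfun (rect_continuous_fst (T := T) cmm).
have bdm := rect_continuous_bounded_mfun (rect_continuous_fst (T := T) cdm).
have LF : L2 (leb2 R) (orect e M T) (L0 m vxx vxt).
  exact: (L2B mO Lvxx (L2M mO bm Lvxt)).
have LF' := L2B mO LF (L2M mO bdm Lvt).
have i1 := L2_integrable mO bphi LF; have i2 := L2_integrable mO bphi Lvt.
have i3 := L2_integrable mO bphi LF'.
have Fle : \int[leb2 R]_(z in orect e M T) (phi z *
     (vxx z - m z.1 * vxt z - dm z.1 * vt z) ^+ 2) <=
   2 * inside (L0 m vxx vxt) + 2 * m2 ^+ 2 * inside vt.
  rewrite /inside -!RintegralZl// -RintegralD//; try exact: integrableRZ.
  apply: le_Rintegral => //.
    by apply: integrableRD => //; exact: integrableRZ.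
  move=> z [/= z1 _].
  have hdm : `|dm z.1| <= m2.
    by rewrite m2E; apply: le_max_norm => //;
      [exact: segment_compact|exact: subset_itv_oo_cc].
  rewrite !(mulrCA _ (phi z)) -mulrDr; apply: ler_wpM2l; first exact: weight_ge0.
  apply: (@le_trans _ _ (2 * L0 m vxx vxt z ^+ 2 + 2 * dm z.1 ^+ 2 * vt z ^+ 2)).
    by rewrite /L0; have := sqr_ge0 (vxx z - m z.1 * vxt z + dm z.1 * vt z); lra.
  rewrite lerD2l; apply: ler_wpM2r; first exact: sqr_ge0.
  rewrite ler_pM2l// -(real_normK (num_real (dm z.1))) lerXn2r ?nnegrE//.
  exact: le_trans hdm.
have [_ [Lvxe _] [Lvte _] _ _ _ _] := tr.
have Lqe := L2B mT Lvxe (L2M mT (bounded_mfun_cst _ (m e)) Lvte).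
have j1 := L2_integrable mT bphie Lvxe; have j2 := L2_integrable mT bphie Lvte.
have j3 := L2_integrable mT bphie Lqe.
have Ele : edge_e (fun t => vx_e t - m e * vt_e t) <=
    2 * edge_e vx_e + 2 * m1 ^+ 2 * edge_e vt_e.
  have /andP[me0 me1] := hm _ e_in.
  rewrite /edge_e -!RintegralZl// -RintegralD//; try exact: integrableRZ.
  apply: le_Rintegral => //.
    by apply: integrableRD => //; exact: integrableRZ.
  move=> t _.
  rewrite !(mulrCA _ (phi (e, t))) -mulrDr; apply: ler_wpM2l; first exact: weight_ge0.
  apply: (@le_trans _ _ (2 * vx_e t ^+ 2 + 2 * m e ^+ 2 * vt_e t ^+ 2)).
    by have := sqr_ge0 (vx_e t + m e * vt_e t); lra.
  rewrite lerD2l; apply: ler_wpM2r; first exact: sqr_ge0.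
  have me_gt0 : 0 < m e by exact: lt_trans me0.
  by rewrite ler_pM2l// lerXn2r ?nnegrE ?ltW//; exact: lt_trans me1.
have l2 : 0 <= lambda / 2 by rewrite divr_ge0.
have {}Ele := ler_wpM2l l2 Ele.
rewrite -/(inside _) -/(edge_e _) => main.
apply: (le_trans main); apply: (le_trans (lerD Fle Ele)).
rewrite lerD2l; set a := edge_e vx_e; set b := edge_e vt_e.
by rewrite le_eqVlt; apply/orP; left; apply/eqP; field.
Qed.

Lemma carleman_core :
  3 / 16 * (lambda ^+ 2 * inside vx) + m0 ^+ 2 / 32 * (lambda ^+ 2 * inside vt)
  + lambda ^+ 4 / 64 * inside v
  + m0 / 2 * (lambda * edge_t 0 vx_0) + m0 / 32 * (lambda ^+ 3 * edge_t 0 v_0) <=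
  4 * inside (L0 m vxx vxt)
  + lambda * (2 * edge_e vx_e + m1 ^+ 2 * edge_e vt_e)
  + lambda ^+ 3 / 32 * edge_e v_e
  + m1 * (lambda * edge_t T vx_T) + m1 / 32 * (lambda ^+ 3 * edge_t T v_T).
Proof.
have [m0_gt0 m01 hm [dm [dmE m2E]]] := cm; have [cmm cdm _] := dmE.
have [H1v Hvx Hvt] := Hv; have [tve tvxe tvte tv0 tvx0 tvT tvxT] := tr.
have l0 : 0 <= lambda by exact: le_trans l1.
have bb x : x \in `[e, M] -> m0 <= m x <= m1.
  by move=> /hm /andP[h h']; rewrite !ltW.
have A := transport_H1 eM T0 l0 a0 am1 cmm bb Hvx tvxe tvx0 tvxT.
have C := transport_H1 eM T0 l0 a0 am1 cmm bb H1v tve tv0 tvT.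
have m2_ge0 : 0 <= m2.
  by rewrite m2E; apply: max_norm_ge0 cdm e_in; exact: segment_compact.
apply: (combine_estimates l0 m0_gt0 m01 m2_ge0 lm2 _ _ _ _ _ _ A conormal_estimate
  C inside_conormal_ge).
- exact: inside_ge0.
- exact: inside_ge0.
- exact: edge_e_ge0.
- exact: edge_e_ge0.
- exact: edge_t_ge0.
- exact: edge_t_ge0.
Qed.

(** Both estimates are instances: J is the mixed integral and G bounds g and its
    t-derivative, or G = J = 0. *)
Lemma carleman_with_defect (G J : R) : 0 <= G ->
  32 * (G * (1 + m1^-1)) <= lambda ->
  16 * (16 * G + 8 * (G * (1 + m1^-1)) * T) <= lambda * m0 ->
  - mixed_defect e M T lambda alpha G vx vx_0 vx_T v_0 <= J ->
  carleman_rhs e M T lambda alpha (Num.min 1 (m0 ^+ 2) / 16 / 16) (1 + m1 ^+ 2)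
    (m0 / 16 / 16) (m1 + G) v vx vt v_e vx_e vt_e v_0 vx_0 v_T vx_T <=
  \int[leb2 R]_(z in orect e M T) (phi z * L0 m vxx vxt z ^+ 2) + J.
Proof.
move=> G0 kl GTl defect; have [m0_gt0 m01 _ _] := cm.
have m1_gt0 : 0 < m1 by exact: lt_trans m01.
have l0 : 0 <= lambda by exact: le_trans l1.
have k0 : 0 <= G * (1 + m1^-1) by rewrite mulr_ge0// addr_ge0// invr_ge0 ltW.
have Gam_le : (G + 2 * lambda * alpha * G) / 2 <= lambda * (G * (1 + m1^-1)) / 2.
  have al : 2 * alpha <= m1^-1.
    by rewrite -[leRHS]mul1r ler_pdivlMr//; have := am1; lra.
  have h1 := ler_wpM2l (mulr_ge0 l0 G0) al.
  have h2 : G <= lambda * G by exact: ler_peMl.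
  by rewrite ler_pM2r ?invr_gt0//; lra.
rewrite carleman_rhsE -/(inside (L0 m vxx vxt)).
apply: (absorb_mixed l1 (ltW T0) m0_gt0 m1_gt0 G0 k0 _ _ kl GTl Gam_le
  (inside_ge0 vx) (inside_ge0 vt) (inside_ge0 v)
  (edge_e_ge0 vx_e) (edge_e_ge0 vt_e) (edge_e_ge0 v_e)
  (edge_t_ge0 0 vx_0) (edge_t_ge0 0 v_0) (edge_t_ge0 T vx_T) (edge_t_ge0 T v_T)
  defect carleman_core).
- by do 2! (apply: ler_wpM2r; first by rewrite invr_ge0); rewrite ge_min lexx.
- by do 2! (apply: ler_wpM2r; first by rewrite invr_ge0); rewrite ge_min lexx orbT.
Qed.

End Combination.

(** * The two Carleman estimates *)

Theorem theorem3p1 (R : realType) :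
  (exists (alpha0 lambda0 : forall m0 m1 m2 e T : R, R)
          (C1 C2 C3 C4 : forall m0 m1 m2 e M : R, R),
    forall (m0 m1 m2 e M T : R) (m : R -> R),
      0 < e < 1 -> 1 < M -> 0 < T ->
      coefficient e M m0 m1 m2 m ->
      [/\ 0 < alpha0 m0 m1 m2 e T, 1 <= lambda0 m0 m1 m2 e T &
          [/\ 0 < C1 m0 m1 m2 e M, 0 < C2 m0 m1 m2 e M,
              0 < C3 m0 m1 m2 e M & 0 < C4 m0 m1 m2 e M]] /\
      forall alpha lambda : R,
        0 < alpha < alpha0 m0 m1 m2 e T ->
        lambda0 m0 m1 m2 e T <= lambda ->
      forall (v vx vt vxx vxt vtt : R * R -> R)
             (v_e vx_e vt_e v_0 vx_0 v_T vx_T : R -> R),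
        H2 (orect e M T) v vx vt vxx vxt vtt ->
        traces e M T v vx vt vxx vxt vtt v_e vx_e vt_e v_0 vx_0 v_T vx_T ->
        carleman_rhs e M T lambda alpha
          (C1 m0 m1 m2 e M) (C2 m0 m1 m2 e M)
          (C3 m0 m1 m2 e M) (C4 m0 m1 m2 e M)
          v vx vt v_e vx_e vt_e v_0 vx_0 v_T vx_T
        <= \int[leb2 R]_(z in orect e M T)
             (weight lambda alpha z * L0 m vxx vxt z ^+ 2))
  /\
  (exists (alpha0 lambda0 : forall m0 m1 m2 e M G T : R, R)
          (C1 C2 C3 C4 : forall m0 m1 m2 e M G : R, R),
    forall (m0 m1 m2 e M T G : R) (m : R -> R) (g gx gt : R * R -> R),
      0 < e < 1 -> 1 < M -> 0 < T ->
      coefficient e M m0 m1 m2 m ->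
      C1_rect e M T g gx gt -> G = C1_norm e M T g gx gt ->
      [/\ 0 < alpha0 m0 m1 m2 e M G T, 1 <= lambda0 m0 m1 m2 e M G T &
          [/\ 0 < C1 m0 m1 m2 e M G, 0 < C2 m0 m1 m2 e M G,
              0 < C3 m0 m1 m2 e M G & 0 < C4 m0 m1 m2 e M G]] /\
      forall alpha lambda : R,
        0 < alpha < alpha0 m0 m1 m2 e M G T ->
        lambda0 m0 m1 m2 e M G T <= lambda ->
      forall (v vx vt vxx vxt vtt : R * R -> R)
             (v_e vx_e vt_e v_0 vx_0 v_T vx_T : R -> R),
        H2 (orect e M T) v vx vt vxx vxt vtt ->
        traces e M T v vx vt vxx vxt vtt v_e vx_e vt_e v_0 vx_0 v_T vx_T ->
        carleman_rhs e M T lambda alpha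
          (C1 m0 m1 m2 e M G) (C2 m0 m1 m2 e M G)
          (C3 m0 m1 m2 e M G) (C4 m0 m1 m2 e M G)
          v vx vt v_e vx_e vt_e v_0 vx_0 v_T vx_T
        <= (\int[leb2 R]_(z in orect e M T)
              (weight lambda alpha z * L0 m vxx vxt z ^+ 2))
           + (\int[leb2 R]_(z in orect e M T)
                (weight lambda alpha z * (g z * vxt z * v_0 z.1)))).
Proof.
have c_gt0 (m0 : R) : 0 < m0 -> 0 < Num.min 1 (m0 ^+ 2) / 16 / 16.
  by move=> m0_gt0; do 2! apply: divr_gt0 => //; rewrite lt_min ltr01 exprn_gt0.
have c2_gt0 (m1 : R) : 0 < 1 + m1 ^+ 2 by rewrite ltr_pwDl// sqr_ge0.
have c3_gt0 (m0 : R) : 0 < m0 -> 0 < m0 / 16 / 16.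
  by move=> m0_gt0; do 2! apply: divr_gt0 => //.
have m2_ge0 (e M m0 m1 m2 : R) m : e < M -> coefficient e M m0 m1 m2 m -> 0 <= m2.
  move=> eM [_ _ _ [dm [[_ cdm _] ->]]].
  by apply: (max_norm_ge0 (z := e)) cdm _;
    [exact: segment_compact|rewrite /= in_itv /= lexx ltW].
have am1_le (m1 alpha : R) : 0 < m1 -> alpha < (2 * m1)^-1 -> alpha * m1 <= 2^-1.
  by move=> m1_gt0; rewrite invfM => /ltW h; rewrite -ler_pdivlMr.
have lm2_le (m0 m2 lambda : R) : 0 < m0 -> 8 * (m2 / m0) <= lambda ->
    8 * m2 <= lambda * m0.
  by move=> m0_gt0; rewrite mulrA ler_pdivrMr.
split.
  (* alpha0 ensures alpha m <= 1/2; lambda0 ensures the absorption of m' v_t. *)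
  exists (fun _ m1 _ _ _ => (2 * m1)^-1).
  exists (fun m0 _ m2 _ _ => 1 + 8 * (m2 / m0)).
  exists (fun m0 _ _ _ _ => Num.min 1 (m0 ^+ 2) / 16 / 16).
  exists (fun _ m1 _ _ _ => 1 + m1 ^+ 2).
  exists (fun m0 _ _ _ _ => m0 / 16 / 16).
  exists (fun _ m1 _ _ _ => m1).
  move=> m0 m1 m2 e M T m /andP[e0 e1] M1 T0 cm.
  have eM : e < M by exact: lt_trans M1.
  have [m0_gt0 m01 _ _] := cm; have m1_gt0 := lt_trans m0_gt0 m01.
  have m20 : 0 <= 8 * (m2 / m0).
    by rewrite mulr_ge0// divr_ge0//; [exact: m2_ge0 cm|exact: ltW].
  split; first split.
  - by rewrite invr_gt0 mulr_gt0.
  - by rewrite lerDl.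
  - by split; [exact: c_gt0|exact: c2_gt0|exact: c3_gt0|].
  move=> alpha lambda /andP[al0 al1] lam v vx vt vxx vxt vtt
    v_e vx_e vt_e v_0 vx_0 v_T vx_T Hv tr.
  have l1 : 1 <= lambda by apply: le_trans lam; rewrite lerDl.
  have lm2 : 8 * m2 <= lambda * m0.
    by apply: lm2_le => //; apply: le_trans lam; rewrite lerDr.
  have l0 : 0 <= lambda by exact: le_trans l1.
  have am1 := am1_le _ _ m1_gt0 al1.
  (* Without mixed term, the defect vanishes. *)
  have := carleman_with_defect (G := 0) (J := 0) eM T0 cm (ltW al0) am1 l1 lm2 Hv tr.
  rewrite !addr0; apply => //.
  - by rewrite mul0r mulr0.
  - by rewrite mulr0 mul0r mulr0 mul0r add0r mulr0 mulr_ge0// ltW.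
  - by rewrite /mixed_defect !(mul0r, mulr0, addr0) oppr0.
(* lambda k / 2 bounds the interior coefficient of the defect for alpha < alpha0; the
   last two terms of lambda0 let carleman_core absorb the defect. *)
pose k (m1 G : R) := G * (1 + m1^-1).
exists (fun _ m1 _ _ _ _ _ => (2 * m1)^-1).
exists (fun m0 m1 m2 _ _ G T => 1 + 8 * (m2 / m0) + 32 * k m1 G
  + 16 * (16 * G + 8 * k m1 G * T) / m0).
exists (fun m0 _ _ _ _ _ => Num.min 1 (m0 ^+ 2) / 16 / 16).
exists (fun _ m1 _ _ _ _ => 1 + m1 ^+ 2).
exists (fun m0 _ _ _ _ _ => m0 / 16 / 16).
exists (fun _ m1 _ _ _ G => m1 + G).
move=> m0 m1 m2 e M T G m g gx gt /andP[e0 e1] M1 T0 cm Cg GE.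
have eM : e < M by exact: lt_trans M1.
have [m0_gt0 m01 _ _] := cm; have m1_gt0 := lt_trans m0_gt0 m01.
have [cg cgx cgt _] := Cg; have [_ dgt] := C1_rect_slices Cg.
have cc : compact (crect e M T) by exact: compact_crect.
have n0 (f : R * R -> R) : rect_continuous e M T f -> 0 <= max_norm (crect e M T) f.
  move=> cf; apply: (max_norm_ge0 (z := (e, 0)) cc cf).
  by split; rewrite /= in_itv /= lexx ltW.
have hg z : crect e M T z -> `|g z| <= G.
  move=> Dz; rewrite GE /C1_norm; have := le_max_norm cc cg Dz.
  by have := n0 _ cgx; have := n0 _ cgt; lra.
have hgt z : crect e M T z -> `|gt z| <= G.
  move=> Dz; rewrite GE /C1_norm; have := le_max_norm cc cgt Dz.
  by have := n0 _ cgx; have := n0 _ cg; lra.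
have G0 : 0 <= G by rewrite GE /C1_norm !addr_ge0// n0.
have k0 : 0 <= k m1 G by rewrite mulr_ge0// addr_ge0// invr_ge0 ltW.
have m20 : 0 <= 8 * (m2 / m0).
  by rewrite mulr_ge0// divr_ge0//; [exact: m2_ge0 cm|exact: ltW].
have k320 : 0 <= 32 * k m1 G by rewrite mulr_ge0.
have kT0 : 0 <= 16 * (16 * G + 8 * k m1 G * T) / m0.
  apply: divr_ge0; last exact: ltW.
  apply: mulr_ge0 => //; apply: addr_ge0; first exact: mulr_ge0.
  by apply: mulr_ge0; [exact: mulr_ge0|exact: ltW].
split; first split.
- by rewrite invr_gt0 mulr_gt0.
- by rewrite -!addrA lerDl !addr_ge0.
- by split; [exact: c_gt0|exact: c2_gt0|exact: c3_gt0|rewrite ltr_pwDl].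
move=> alpha lambda /andP[al0 al1] lam v vx vt vxx vxt vtt
  v_e vx_e vt_e v_0 vx_0 v_T vx_T Hv tr.
have l1 : 1 <= lambda by lra.
have lm2 : 8 * m2 <= lambda * m0 by apply: lm2_le => //; lra.
have l0 : 0 <= lambda by exact: le_trans l1.
have am1 := am1_le _ _ m1_gt0 al1.
apply: (carleman_with_defect eM T0 cm (ltW al0) am1 l1 lm2 Hv tr G0).
- by rewrite -/(k m1 G); lra.
- by rewrite -/(k m1 G) -ler_pdivrMr//; lra.
have [_ Hvx _] := Hv; have [_ _ _ [Lv0 _] tvx0 _ tvxT] := tr.
apply: (le_trans (mixed_H1 eM T0 l0 (ltW al0) cg cgt dgt hg hgt Hvx tvx0 tvxT Lv0)).
rewrite le_eqVlt; apply/orP; left; apply/eqP.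
by apply: eq_Rintegral => z _; ring.
Qed.
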